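(* Let $\mathcal{C}\subseteq\mathcal{M}(\Omega)$ be an effectively compact class of probability measures on $\Omega$. Then (a) there exists a universal $\mathcal{C}$-test $\mathbf{t}_{\mathcal{C}}$; (b) $\mathbf{t}_{\mathcal{C}}(\omega)\doteq\inf_{P\in\mathcal{C}}\mathbf{t}(\omega,P)$ for all $\omega$, where $\mathbf{t}$ is a universal uniform test (equivalently, $\omega\mapsto\inf_{P\in\mathcal{C}}\mathbf{t}(\omega,P)$ is itself a universal $\mathcal{C}$-test).
   Context: $\Omega=\{0,1\}^{\mathbb{N}}$; $\mathcal{M}(\Omega)$ is the space of probability measures on $\Omega$, with basic sets defined by finitely many conditions $u<P(y)<v$ ($y$ a word, $u,v$ rational, $P(y)=P(y\Omega)$). A set $\mathcal{C}$ is effectively compact if it is compact and the set of finite families of basic sets covering $\mathcal{C}$ is enumerable. A function $t:\Omega\to[0,\infty]$ is lower semicomputable if each $\{\omega:r<t(\omega)\}$ ($r$ rational) is a union of an enumerable family of intervals $x\Omega$, uniformly in $r$; similarly on $\Omega\times\mathcal{M}(\Omega)$ with basic open sets $x\Omega\times\beta$. A $\mathcal{C}$-test is a lower semicomputable $t:\Omega\to[0,\infty]$ with $\int t\,dP\le1$ for all $P\in\mathcal{C}$; universal means maximal up to a multiplicative constant. A uniform test is a lower semicomputable $t(\omega,P)\ge0$ with $\int t(\omega,P)\,dP(\omega)\le1$ for all $P\in\mathcal{M}(\Omega)$; $\mathbf{t}$ is a maximal one up to a multiplicative constant. $f\doteq g$ means equality up to bounded multiplicative factors. *)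

(* Defs.v *)
From HB Require Import structures.
From mathcomp Require Import all_boot all_order all_algebra.
From mathcomp Require Import all_classical all_reals all_analysis.

Set Implicit Arguments.
Unset Strict Implicit.
Unset Printing Implicit Defensive.

Import Order.TTheory GRing.Theory Num.Theory.

Local Open Scope classical_set_scope.
Local Open Scope ring_scope.

(** * Computability *)

(* Programs for Kleene's partial recursive functions. Arities are not tracked:
   arguments form a list, and a missing argument reads as 0. *)
Inductive recfun : Type :=
| RZero
| RSucc
| RProj of nat
| RComp of recfun & seq recfun
| RRec of recfun & recfun
| RMin of recfun.

(* [computes f xs y]: the partial function f is defined at xs, with value y.
   In particular
     RRec g h (0 :: xs) = g xs,
     RRec g h (n.+1 :: xs) = h (n :: RRec g h (n :: xs) :: xs),
     RMin g xs = the least n such that g (n :: xs) = 0, where g (m :: xs) has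
                 to be defined for every m < n. *)
Fixpoint computes (f : recfun) (xs : seq nat) (y : nat) {struct f} : Prop :=
  match f with
  | RZero => y = 0%N
  | RSucc => y = (nth 0%N xs 0).+1
  | RProj i => y = nth 0%N xs i
  | RComp g hs =>
      exists2 ys : seq nat,
        (fix all_compute (hs : seq recfun) (ys : seq nat) {struct hs} : Prop :=
           match hs, ys with
           | [::], [::] => True
           | h :: hs', z :: ys' => computes h xs z /\ all_compute hs' ys'
           | _, _ => False
           end) hs ys
        & computes g ys y
  | RRec g h =>
      (fix iterate (n : nat) (z : nat) {struct n} : Prop :=
         match n with
         | 0%N => computes g (behead xs) z
         | m.+1 => exists2 r : nat,
             iterate m r & computes h [:: m, r & behead xs] z
         end) (head 0%N xs) y
  | RMin g =>
      computes g (y :: xs) 0%N /\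
      forall m : nat, (m < y)%N ->
        exists k : nat, computes g (m :: xs) k.+1
  end.

(* [A] is the set of outputs of some algorithm. Elements of T are represented
   by their codes [pickle x]; for the types used below (words, rationals, and
   pairs and lists of these) [pickle] is an explicit, axiom-free arithmetical
   coding. *)
Definition enumerable (T : countType) (A : set T) : Prop :=
  exists f : recfun,
    pickle @` A = [set n | exists k : nat, computes f [:: k] n].

(** * Binary sequences and the probability measures on them *)

Definition word : Type := seq bool.
HB.instance Definition _ := Countable.on word.

(* The interval x Omega. *)
Definition cylinder (x : word) : set (nat -> bool) :=
  [set w | mkseq w (size x) = x].

(* The sequences with the Borel sigma-algebra. *)
Definition Omega : Type := g_sigma_algebraType (range cylinder).
HB.instance Definition _ := Measurable.on Omega.

Definition measures (R : realType) : Type := probability Omega R.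
HB.instance Definition _ (R : realType) := Pointed.on (measures R).

(* A list of conditions (y, u, v), each of which reads u < P(y) < v. *)
Definition basic : Type := seq (word * rat * rat).
HB.instance Definition _ := Countable.on basic.

Section Tests.
Variable R : realType.
Local Open Scope ereal_scope.

Definition basic_set (b : basic) : set (measures R) :=
  [set P | forall y u v, (y, u, v) \in b ->
     (ratr u)%:E < P (cylinder y) < (ratr v)%:E].

HB.instance Definition _ :=
  @isSubBaseTopological.Build (measures R) (set (measures R))
    (range basic_set) id.

Definition effectively_compact (C : set (measures R)) : Prop :=
  compact C /\
  enumerable
    [set F : seq basic | C `<=` \bigcup_(b in [set` F]) basic_set b].

(* The sets [base b] are the basic open sets of X. That E is a single set of
   pairs (r, b) expresses uniformity in r. *)
Definition lower_semicomputable (X : Type) (B : countType) (base : B -> set X)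
    (t : X -> \bar R) : Prop :=
  exists2 E : set (rat * B), enumerable E &
    forall r : rat,
      [set x | (ratr r)%:E < t x] = \bigcup_(b in [set b | E (r, b)]) base b.

Definition basic_prod (b : word * basic) : set (Omega * measures R) :=
  cylinder b.1 `*` basic_set b.2.

Definition dominated (X : Type) (f g : X -> \bar R) : Prop :=
  exists2 c : R, (0 < c)%R & forall x, f x <= c%:E * g x.

Definition eq_up_to_factor (X : Type) (f g : X -> \bar R) : Prop :=
  dominated f g /\ dominated g f.

Definition is_test (C : set (measures R)) (t : Omega -> \bar R) : Prop :=
  [/\ forall w, 0 <= t w,
      lower_semicomputable cylinder t &
      forall P, C P -> \int[P]_w t w <= 1].

Definition universal_test (C : set (measures R)) (t : Omega -> \bar R) : Prop :=
  is_test C t /\ forall s, is_test C s -> dominated s t.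

Definition is_uniform_test (t : Omega * measures R -> \bar R) : Prop :=
  [/\ forall z, 0 <= t z,
      lower_semicomputable basic_prod t &
      forall P : measures R, \int[P]_w t (w, P) <= 1].

Definition universal_uniform_test (t : Omega * measures R -> \bar R) : Prop :=
  is_uniform_test t /\ forall s, is_uniform_test s -> dominated s t.

(* Equal to +oo everywhere when C is empty. *)
Definition inf_test (C : set (measures R)) (t : Omega * measures R -> \bar R)
    (w : Omega) : \bar R :=
  ereal_inf [set t (w, P) | P in C].

End Tests.

(* Main.v *)
Require Import Defs.
From HB Require Import structures.
From mathcomp Require Import all_boot all_order all_algebra.
From mathcomp Require Import all_classical all_reals all_analysis.
From mathcomp Require Import measurable_realfun zify ring lra.

(* A C-test s is turned into a uniform test by trimming: s is the limit of an
   increasing sequence of computable step functions s_n, and the supremum of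
   the s_n with [int s_n dP < 2], a condition that is effectively open in P, has
   integral at most 2 for every P and equals s when P is in C. Trimming all
   lower semicomputable functions t_i and taking sup_i 2^-(i+2) (trimmed t_i)
   gives one uniform test u that does not depend on C and satisfies
   s(w) <= c u(w, P) for all P in C and every C-test s; a universal uniform test
   inherits this property. On the other hand inf_C t(w, P) is a C-test for each
   uniform test t: by effective compactness, r < inf_C t(w, P) is witnessed by
   finitely many basic sets that cover C and on which t(w, .) > q > r. *)

Set Implicit Arguments.
Unset Strict Implicit.
Unset Printing Implicit Defensive.

Import Order.TTheory GRing.Theory Num.Theory.

Local Open Scope nat_scope.

(** * Total recursive functions *)

(** The bound 2 leaves room above the bound 1 that holds for a test: only strict inequalities
    between probabilities and rationals can be recognized in finite time, and approximating P from
    above must not lose a stage of a genuine test. The weights 2^-(i+2) then bring the total to at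
    most the sum of the 2^-(i+1), which is 1. The index i runs over all numbers, without any
    filtering: whatever a program enumerates, its trimmed version has integral at most 2, and
    outputs that are not codes of pairs only destroy certificates. Treating all programs at once
    requires an enumeration that is uniform in the index, and this is the main obstacle, since
    [computes] is a relation on syntax. The enumeration is obtained from derivations, finite lists
    of facts about programs in which each fact is justified by others; being a derivation is
    semidecidable. It also turns every [enumerable] hypothesis into a [semidec] one, the form in
    which effectiveness is handled throughout; [semidec_enumerable] leads back. *)

Definition computable (F : seq nat -> nat) : Prop :=
  exists f : recfun, forall xs y, computes f xs y <-> y = F xs.

Lemma eq_computable F G : F =1 G -> computable F -> computable G.
Proof. by move=> FG [f fP]; exists f => xs y; rewrite -FG. Qed.

Lemma computable_nth i : computable (fun xs => nth 0 xs i).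
Proof. by exists (RProj i). Qed.

Lemma computable_comp1 G H :
  computable G -> computable H -> computable (fun xs => G [:: H xs]).
Proof.
move=> [g gP] [h hP]; exists (RComp g [:: h]) => xs y /=; split.
  by case=> [[|z [|? ?]]] [] // /hP -> _ /gP.
by move=> ->; exists [:: H xs]; [split=> //; exact/hP | exact/gP].
Qed.

Lemma computable_comp2 G H1 H2 : computable G -> computable H1 ->
  computable H2 -> computable (fun xs => G [:: H1 xs; H2 xs]).
Proof.
move=> [g gP] [h1 h1P] [h2 h2P]; exists (RComp g [:: h1; h2]) => xs y /=; split.
  by case=> [[|z [|z' [|? ?]]]] [] // /h1P -> [] // /h2P -> _ /gP.
move=> ->; exists [:: H1 xs; H2 xs]; last exact/gP.
by do 2![split; first by [exact/h1P | exact/h2P]].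
Qed.

Lemma computable_zero : computable (fun=> 0).
Proof. by exists RZero. Qed.

Lemma computable_succ F : computable F -> computable (fun xs => (F xs).+1).
Proof.
move=> cF; apply: (@computable_comp1 (fun xs => (nth 0 xs 0).+1)) => //.
by exists RSucc.
Qed.

Lemma computable_const n : computable (fun=> n).
Proof.
elim: n => [|n IHn]; [exact: computable_zero | exact: computable_succ].
Qed.

(* The environment is truncated to two variables because RComp passes on a list
   of fixed length. *)
Lemma computable_rec N G H : computable N -> computable G -> computable H ->
  computable (fun xs => nat_rect (fun=> nat) (G [:: nth 0 xs 0; nth 0 xs 1])
    (fun m r => H [:: m; r; nth 0 xs 0; nth 0 xs 1]) (N xs)).
Proof.
move=> [n nP] [g gP] [h hP].
exists (RComp (RRec g h) [:: n; RProj 0; RProj 1]) => xs y.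
set a := nth 0 xs 0; set b := nth 0 xs 1.
set R := nat_rect _ _ _.
have recP k z : computes (RRec g h) [:: k; a; b] z <-> z = R k.
  rewrite /=; elim: k z => [|k IHk] z; first exact: gP.
  split=> [[r /IHk -> /hP]//|->]; exists (R k); [exact/IHk | exact/hP].
split.
  by case=> [[|z [|z' [|z'' [|? ?]]]]] [] // /nP -> [] // -> [] // -> _ /recP.
move=> ->; exists [:: N xs; a; b]; last exact/recP.
by split; first exact/nP.
Qed.

Lemma computable_min G (exG : forall xs, exists y, G (y :: xs) == 0) :
  computable G -> computable (fun xs => ex_minn (exG xs)).
Proof.
move=> [g gP]; exists (RMin g) => xs y /=.
case: ex_minnP => m /eqP m0 mmin; split=> [[/gP/esym y0 ylt]|->].
  apply/eqP; rewrite eqn_leq mmin ?y0 ?eqxx// andbT leqNgt; apply/negP => lt_my.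
  by have [k /gP] := ylt _ lt_my; rewrite m0.
split=> [|k lt_km]; first exact/gP.
exists (G (k :: xs)).-1; apply/gP; rewrite prednK// lt0n.
by apply: contraL lt_km => /mmin; rewrite -leqNgt.
Qed.

Definition computable1 (f : nat -> nat) :=
  forall F, computable F -> computable (fun xs => f (F xs)).

Definition computable2 (f : nat -> nat -> nat) :=
  forall F G, computable F -> computable G -> computable (fun xs => f (F xs) (G xs)).

Lemma computable1P f : computable (fun xs => f (nth 0 xs 0)) -> computable1 f.
Proof. by move=> cf F cF; apply: computable_comp1 cf cF. Qed.

Lemma computable2P f :
  computable (fun xs => f (nth 0 xs 0) (nth 0 xs 1)) -> computable2 f.
Proof. by move=> cf F G cF cG; apply: computable_comp2 cf cF cG. Qed.

Lemma computable_add : computable2 addn.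
Proof.
apply: computable2P.
apply: eq_computable (computable_rec (computable_nth 1) (computable_nth 0)
  (computable_succ (computable_nth 1))) => xs /=.
by elim: (nth 0 xs 1) => [|n IHn] /=; rewrite ?addn0// IHn addnS.
Qed.

Lemma computable_mul : computable2 muln.
Proof.
apply: computable2P.
apply: eq_computable (computable_rec (computable_nth 1) computable_zero
  (computable_add (computable_nth 1) (computable_nth 2))) => xs /=.
by elim: (nth 0 xs 1) => [|n IHn] /=; rewrite ?muln0// IHn mulnSr.
Qed.

Lemma computable_pred : computable1 predn.
Proof.
apply: computable1P.
apply: eq_computable (computable_rec (computable_nth 0) computable_zero
  (computable_nth 0)) => xs /=.
by case: (nth 0 xs 0).
Qed.

Lemma computable_sub : computable2 subn.
Proof.
apply: computable2P.
apply: eq_computable (computable_rec (computable_nth 1) (computable_nth 0)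
  (computable_pred (computable_nth 1))) => xs /=.
by elim: (nth 0 xs 1) => [|n IHn] /=; rewrite ?subn0// IHn subnS.
Qed.

Lemma computable_exp : computable2 expn.
Proof.
apply: computable2P.
apply: eq_computable (computable_rec (computable_nth 1) (computable_const 1)
  (computable_mul (computable_nth 1) (computable_nth 2))) => xs /=.
by elim: (nth 0 xs 1) => [|n IHn] /=; rewrite ?expn0// IHn expnSr.
Qed.

(** The quotient is the least y with c < (y + 1) 2^h, so minimization finds it; the truncated
    subtraction in [G] vanishes exactly when this inequality holds. *)
Lemma computable_half_iter : computable2 (fun c h => c %/ 2 ^ h).
Proof.
apply: computable2P.
pose G (xs : seq nat) :=
  (nth 0 xs 1).+1 - (nth 0 xs 0).+1 * 2 ^ nth 0 xs 2.
have exG xs : exists y, G (y :: xs) == 0.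
  exists (nth 0 xs 0); rewrite /G subn_eq0 /= leq_pmulr// expn_gt0//.
have cG : computable G.
  apply: computable_sub; first exact: computable_succ (computable_nth _).
  apply: computable_mul; first exact: computable_succ (computable_nth _).
  exact: computable_exp (computable_const _) (computable_nth _).
apply: eq_computable (computable_min exG cG) => xs.
case: ex_minnP => m; rewrite /G subn_eq0 /= => lt_m mmin.
have p0 : 0 < 2 ^ nth 0 xs 1 by rewrite expn_gt0.
apply/eqP; rewrite eqn_leq; apply/andP; split.
  by apply: mmin; rewrite /= subn_eq0 ltn_ceil.
by rewrite -ltnS ltn_divLR.
Qed.

(** * Arithmetic of coded lists *)

Definition head_code (c : nat) := head 0 (CodeSeq.decode c).
Definition behead_code (c : nat) := CodeSeq.code (behead (CodeSeq.decode c)).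
(** The formula of [CodeSeq.code] on a cons, the empty list having code 0. The head is thus the
    exponent of 2 in the code, and shifting out the lowest binary digit 1 with the zeros below it
    leaves the code of the tail. *)
Definition cons_code (n c : nat) := 2 ^ n * c.*2.+1.

Lemma computable_cons : computable2 cons_code.
Proof.
move=> F G cF cG; apply: computable_mul.
  exact: computable_exp (computable_const _) cF.
apply: computable_succ; apply: eq_computable (computable_add cG cG) => xs.
by rewrite addnn.
Qed.

Lemma half_cons_code n c h :
  h <= n -> cons_code n c %/ 2 ^ h = 2 ^ (n - h) * c.*2.+1.
Proof.
by move=> hn; rewrite /cons_code -(subnK hn) expnD mulnAC mulnK ?addnK ?expn_gt0.
Qed.

Lemma odd_half_cons_code n c h :
  h <= n -> odd (cons_code n c %/ 2 ^ h) = (h == n).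
Proof.
move=> hn; rewrite half_cons_code// oddM oddX /= odd_double andbT orbF.
by rewrite subn_eq0 eqn_leq hn.
Qed.

Lemma cons_codeK c : 0 < c -> cons_code (head_code c) (behead_code c) = c.
Proof.
rewrite /head_code /behead_code -{1 4}[c]CodeSeq.decodeK.
by case: (CodeSeq.decode c).
Qed.

Lemma computable_head : computable1 head_code.
Proof.
apply: computable1P.
(* The first factor is 1 minus the binary digit of the code at the position tried, so the search
   stops at the lowest digit 1. The second factor stops it at 0 for the empty list, in agreement
   with the default of [head]. *)
pose G (xs : seq nat) := (1 - (nth 0 xs 1 %/ 2 ^ nth 0 xs 0
  - 2 * (nth 0 xs 1 %/ 2 ^ (nth 0 xs 0).+1))) * nth 0 xs 1.
have GE xs : (G xs == 0) =
    odd (nth 0 xs 1 %/ 2 ^ nth 0 xs 0) || (nth 0 xs 1 == 0).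
  rewrite /G muln_eq0 expnSr divnMA divn2 mul2n -{1}(odd_double_half (_ %/ _)).
  by rewrite addnK; case: odd.
have GE' xs h : (h <= head_code (nth 0 xs 0)) ->
    (G (h :: xs) == 0) = (h == head_code (nth 0 xs 0)) || (nth 0 xs 0 == 0).
  move=> hh; rewrite GE /=; case: (posnP (nth 0 xs 0)) hh => [->|c0 hh].
    by rewrite !orbT.
  by rewrite -{1}(cons_codeK c0) odd_half_cons_code.
have exG xs : exists y, G (y :: xs) == 0.
  by exists (head_code (nth 0 xs 0)); rewrite GE' ?eqxx.
have cG : computable G.
  have cq := computable_half_iter.
  apply: computable_mul (computable_nth _); apply: (computable_sub (computable_const _)).
  apply: computable_sub; first exact: cq (computable_nth _) (computable_nth _).
  apply: (computable_mul (computable_const _)).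
  exact: cq (computable_nth _) (computable_succ (computable_nth _)).
apply: eq_computable (computable_min exG cG) => xs.
case: ex_minnP => m m0 mmin.
have le_m : m <= head_code (nth 0 xs 0) by apply: mmin; rewrite GE' ?eqxx.
move: m0; rewrite GE'// => /orP[/eqP//|/eqP c0].
by move: le_m; rewrite c0 /head_code leqn0 => /eqP.
Qed.

Lemma computable_behead : computable1 behead_code.
Proof.
move=> F cF.
apply: eq_computable (computable_half_iter cF
  (computable_succ (computable_head cF))) => xs.
case: (posnP (F xs)) => [->|F0]; first by rewrite div0n.
rewrite -{1}(cons_codeK F0) expnSr divnMA half_cons_code// subnn mul1n.
by rewrite divn2 (half_bit_double _ true).
Qed.

Lemma head_codeE s : head_code (CodeSeq.code s) = head 0 s.
Proof. by rewrite /head_code CodeSeq.codeK. Qed.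

Lemma behead_codeE s :
  behead_code (CodeSeq.code s) = CodeSeq.code (behead s).
Proof. by rewrite /behead_code CodeSeq.codeK. Qed.

Definition drop_code c i := CodeSeq.code (drop i (CodeSeq.decode c)).

Lemma computable_drop : computable2 drop_code.
Proof.
apply: computable2P.
apply: eq_computable (computable_rec (computable_nth 1) (computable_nth 0)
  (computable_behead (computable_nth 1))) => xs /=.
elim: (nth 0 xs 1) => [|n IHn] /=.
  by rewrite /drop_code drop0 CodeSeq.decodeK.
by rewrite IHn /behead_code CodeSeq.codeK -drop1 drop_drop add1n.
Qed.

Definition nth_code c i := nth 0 (CodeSeq.decode c) i.

Lemma computable_nth_code : computable2 nth_code.
Proof.
move=> F G cF cG; apply: eq_computable (computable_head (computable_drop cF cG)).
by move=> xs; rewrite head_codeE -nth0 nth_drop addn0.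
Qed.

Definition size_code c := size (CodeSeq.decode c).

Lemma code_eq0 s : (CodeSeq.code s == 0) = nilp s.
Proof. by case: s => //= n s; rewrite muln_eq0 expn_eq0. Qed.

Lemma computable_size : computable1 size_code.
Proof.
apply: computable1P.
pose G (xs : seq nat) := drop_code (nth 0 xs 1) (nth 0 xs 0).
have GE xs h : (G (h :: xs) == 0) = (size_code (nth 0 xs 0) <= h).
  by rewrite /G code_eq0 /nilp size_drop subn_eq0.
have exG xs : exists y, G (y :: xs) == 0.
  by exists (size_code (nth 0 xs 0)); rewrite GE.
have cG : computable G by exact: computable_drop (computable_nth _) (computable_nth _).
apply: eq_computable (computable_min exG cG) => xs.
case: ex_minnP => m; rewrite GE => le_m mmin.
by apply/eqP; rewrite eqn_leq le_m andbT mmin// GE.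
Qed.

(** * Computability on coded types *)

Definition cfun (T U : countType) (h : T -> U) : Prop :=
  exists2 F, computable F & forall x, F [:: pickle x] = pickle (h x).

Definition semidec (T : countType) (P : T -> Prop) : Prop :=
  exists2 F, computable F & forall x, P x <-> exists k, F [:: k; pickle x] = 0.

(** Makes search over [T] possible: among the numbers tried there are some that code no element of
    [T]. On these [cfun] and [semidec] promise nothing, so they have to be rejected. *)
Definition effective (T : countType) : Prop :=
  semidec (fun n : nat => exists x : T, pickle x = n).

Definition pair_code a b := cons_code a (cons_code b 0).

Lemma pickle_pair (T U : countType) (x : T) (y : U) :
  pickle (x, y) = pair_code (pickle x) (pickle y).
Proof. by []. Qed.

Lemma pickle_seqE (T : countType) (s : seq T) :
  pickle s = CodeSeq.code (map pickle s).
Proof. by []. Qed.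

Lemma head_pair_code a b : head_code (pair_code a b) = a.
Proof. exact: (head_codeE [:: a; b]). Qed.

Lemma nth_pair_code a b : nth_code (pair_code a b) 1 = b.
Proof. by rewrite /nth_code (CodeSeq.codeK [:: a; b]). Qed.

Lemma nth_pair_code0 a b : nth_code (pair_code a b) 0 = a.
Proof. by rewrite /nth_code (CodeSeq.codeK [:: a; b]). Qed.

Lemma computable_pair : computable2 pair_code.
Proof.
move=> F G cF cG; apply: computable_cons => //.
exact: computable_cons cG (computable_const _).
Qed.

Lemma pickle_inj (T : countType) : injective (@pickle T).
Proof. exact: pcan_inj pickleK. Qed.

Section ComputableFunctions.
Context {G T U V : countType}.
Implicit Types (g : G).

Lemma eq_cfun (a b : G -> T) : a =1 b -> cfun a -> cfun b.
Proof. by move=> ab [F cF FP]; exists F => // g; rewrite FP ab. Qed.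

Lemma cfun_id : cfun (fun g => g).
Proof. by exists (fun xs => nth 0 xs 0); first exact: computable_nth. Qed.

Lemma cfun_const (c : T) : cfun (fun g => c).
Proof. by exists (fun=> pickle c); first exact: computable_const. Qed.

(** For maps such as [valq] or [CodeSeq.decode], which only change the type under which one and the
    same number is read. *)
Lemma cfun_same_code (h : T -> U) (a : G -> T) :
  (forall x, pickle (h x) = pickle x) -> cfun a -> cfun (fun g => h (a g)).
Proof. by move=> hP [F cF FP]; exists F => // g; rewrite hP. Qed.

Lemma cfun_pair (a : G -> T) (b : G -> U) :
  cfun a -> cfun b -> cfun (fun g => (a g, b g)).
Proof.
move=> [A cA AP] [B cB BP]; exists (fun xs => pair_code (A xs) (B xs)).
  exact: computable_pair.
by move=> g; rewrite AP BP.
Qed.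

Lemma cfun_fst (a : G -> T * U) : cfun a -> cfun (fun g => (a g).1).
Proof.
move=> [A cA AP]; exists (fun xs => head_code (A xs)).
  exact: computable_head.
by move=> g; rewrite AP; case: (a g) => x y; rewrite pickle_pair head_pair_code.
Qed.

Lemma cfun_snd (a : G -> T * U) : cfun a -> cfun (fun g => (a g).2).
Proof.
move=> [A cA AP]; exists (fun xs => nth_code (A xs) 1).
  exact: computable_nth_code cA (computable_const _).
by move=> g; rewrite AP; case: (a g) => x y; rewrite pickle_pair nth_pair_code.
Qed.

Lemma cfun_nat1 f (a : G -> nat) :
  computable1 f -> cfun a -> cfun (fun g => f (a g)).
Proof.
move=> cf [A cA AP]; exists (fun xs => f (A xs)); first exact: cf.
by move=> g; rewrite AP.
Qed.

Lemma cfun_nat2 f (a b : G -> nat) :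
  computable2 f -> cfun a -> cfun b -> cfun (fun g => f (a g) (b g)).
Proof.
move=> cf [A cA AP] [B cB BP]; exists (fun xs => f (A xs) (B xs)); first exact: cf.
by move=> g; rewrite AP BP.
Qed.

Lemma cfun_pickle (a : G -> T) : cfun a -> cfun (fun g => pickle (a g)).
Proof. by move=> [A cA AP]; exists A => // g; rewrite AP. Qed.

Lemma cfun_if (c : G -> bool) (a b : G -> T) :
  cfun c -> cfun a -> cfun b -> cfun (fun g => if c g then a g else b g).
Proof.
move=> [C cC CP] [A cA AP] [B cB BP].
exists (fun xs => C xs * A xs + (1 - C xs) * B xs).
  apply: computable_add; first exact: computable_mul.
  exact: computable_mul (computable_sub (computable_const 1) cC) cB.
move=> g; rewrite AP BP CP; case: (c g) => /=.
  by rewrite mul1n mul0n addn0.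
by rewrite mul0n mul1n.
Qed.

Lemma cfun_leq (a b : G -> nat) :
  cfun a -> cfun b -> cfun (fun g => a g <= b g).
Proof.
move=> [A cA AP] [B cB BP].
exists (fun xs => 1 - (A xs - B xs)).
  exact: computable_sub (computable_const 1) (computable_sub cA cB).
by move=> g; rewrite AP BP /= /leq; case: (a g - b g).
Qed.

Lemma cfun_head (s : G -> seq nat) : cfun s -> cfun (fun g => head 0 (s g)).
Proof.
move=> [S cS SP]; exists (fun xs => head_code (S xs)); first exact: computable_head.
by move=> g; rewrite SP pickle_seqE head_codeE map_id.
Qed.

Lemma cfun_behead (s : G -> seq T) : cfun s -> cfun (fun g => behead (s g)).
Proof.
move=> [S cS SP]; exists (fun xs => behead_code (S xs)); first exact: computable_behead.
by move=> g; rewrite SP pickle_seqE behead_codeE behead_map.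
Qed.

Lemma cfun_cons (a : G -> T) (s : G -> seq T) :
  cfun a -> cfun s -> cfun (fun g => a g :: s g).
Proof.
move=> [A cA AP] [S cS SP]; exists (fun xs => cons_code (A xs) (S xs)).
  exact: computable_cons.
by move=> g; rewrite SP AP.
Qed.

Lemma cfun_drop (s : G -> seq T) (i : G -> nat) :
  cfun s -> cfun i -> cfun (fun g => drop (i g) (s g)).
Proof.
move=> [S cS SP] [I cI IP]; exists (fun xs => drop_code (S xs) (I xs)).
  exact: computable_drop.
by move=> g; rewrite SP IP !pickle_seqE /drop_code CodeSeq.codeK map_drop.
Qed.

Lemma cfun_size (s : G -> seq T) : cfun s -> cfun (fun g => size (s g)).
Proof.
move=> [S cS SP]; exists (fun xs => size_code (S xs)); first exact: computable_size.
by move=> g; rewrite SP pickle_seqE /size_code CodeSeq.codeK size_map.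
Qed.

Lemma cfun_nth x0 (s : G -> seq T) (i : G -> nat) :
  cfun s -> cfun i -> cfun (fun g => nth x0 (s g) (i g)).
Proof.
move=> cs ci; pose h g := i g < size (s g).
have [C cC CP] : cfun h by apply: cfun_leq (cfun_nat1 computable_succ ci) (cfun_size cs).
move: cs ci => [S cS SP] [I cI IP].
(* Beyond the end [nth_code] returns 0, which need not be the code of [x0]; the test [C] switches to
   the right default. *)
exists (fun xs => C xs * nth_code (S xs) (I xs) + (1 - C xs) * pickle x0).
  apply: computable_add; first exact/computable_mul/computable_nth_code.
  exact: computable_mul (computable_sub (computable_const 1) cC) (computable_const _).
move=> g; rewrite SP IP CP pickle_seqE /h /nth_code CodeSeq.codeK /=.
case: ltnP => his; rewrite ?mul1n ?mul0n ?addn0.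
  by rewrite (nth_map x0).
by rewrite nth_default// add0n.
Qed.

Lemma cfun_rec (n : G -> nat) (a : G -> T) (h : nat -> T -> G -> T) :
  cfun n -> cfun a -> cfun (fun p : nat * T * G => h p.1.1 p.1.2 p.2) ->
  cfun (fun g => nat_rect (fun=> T) (a g) (fun m r => h m r g) (n g)).
Proof.
move=> [N cN NP] [A cA AP] [H cH HP].
pose G0 (xs : seq nat) := A [:: nth 0 xs 0].
pose H0 (xs : seq nat) :=
  H [:: pair_code (pair_code (nth 0 xs 0) (nth 0 xs 1)) (nth 0 xs 2)].
have cG0 : computable G0 by exact: computable_comp1 cA (computable_nth _).
have cH0 : computable H0.
  apply: (computable_comp1 cH); apply: computable_pair (computable_nth _).
  exact: computable_pair (computable_nth _) (computable_nth _).
eexists; first exact: (computable_rec cN cG0 cH0).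
move=> g /=; rewrite NP /=; elim: (n g) => [|m IHm] /=; first exact: AP.
by rewrite IHm /H0 /= -[pair_code _ _]/(pickle (m, _, g)) HP.
Qed.

End ComputableFunctions.

Lemma cfun_comp (G T U : countType) (f : T -> U) (a : G -> T) :
  cfun f -> cfun a -> cfun (fun g => f (a g)).
Proof.
move=> [F cF FP] [A cA AP]; exists (fun xs => F [:: A xs]).
  exact: computable_comp1.
by move=> g; rewrite AP FP.
Qed.

Lemma cfun_comp2 (G T U V : countType) (f : T -> U -> V) (a : G -> T) (b : G -> U) :
  cfun (fun z : T * U => f z.1 z.2) -> cfun a -> cfun b ->
  cfun (fun g => f (a g) (b g)).
Proof.
by move=> cf ca cb; exact: (cfun_comp (a := fun g => (a g, b g)) cf (cfun_pair ca cb)).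
Qed.

Section ComputableTests.
Context {G T : countType}.
Implicit Types (g : G).

Lemma cfun_eq (a b : G -> T) : cfun a -> cfun b -> cfun (fun g => a g == b g).
Proof.
move=> ca cb; apply: (@eq_cfun _ _ (fun g =>
    if pickle (a g) <= pickle (b g) then pickle (b g) <= pickle (a g) else false)).
  by move=> g; rewrite -(inj_eq (@pickle_inj T)) eqn_leq; case: leqP.
by apply: cfun_if (cfun_const _); apply: cfun_leq; apply: cfun_pickle.
Qed.

Lemma cfun_and (a b : G -> bool) : cfun a -> cfun b -> cfun (fun g => a g && b g).
Proof. by move=> ca cb; apply: cfun_if ca cb (cfun_const _). Qed.

Lemma cfun_or (a b : G -> bool) : cfun a -> cfun b -> cfun (fun g => a g || b g).
Proof. by move=> ca cb; apply: cfun_if ca (cfun_const true) cb. Qed.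

Lemma cfun_neg (a : G -> bool) : cfun a -> cfun (fun g => ~~ a g).
Proof. by move=> ca; apply: cfun_if ca (cfun_const _) (cfun_const _). Qed.

End ComputableTests.

Lemma cfun_ball (G : countType) (n : G -> nat) (p : nat -> G -> bool) :
  cfun n -> cfun (fun z : nat * G => p z.1 z.2) ->
  cfun (fun g => all (p^~ g) (iota 0 (n g))).
Proof.
move=> cn cp; apply: (@eq_cfun _ _ (fun g =>
    nat_rect (fun=> bool) true (fun m r => r && p m g) (n g))).
  move=> g; elim: (n g) => // m IHm.
  by rewrite -{2}[m.+1]addn1 iotaD all_cat /= -IHm andbT.
apply: cfun_rec cn (cfun_const _) _ => /=; apply: cfun_and.
  exact: cfun_snd (cfun_fst cfun_id).
apply: (cfun_comp2 cp) (cfun_snd cfun_id).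
exact: cfun_fst (cfun_fst cfun_id).
Qed.

Lemma cfun_decode (G : countType) (a : G -> nat) :
  cfun a -> cfun (fun g => CodeSeq.decode (a g)).
Proof.
apply: cfun_same_code => n.
by rewrite pickle_seqE -[RHS]CodeSeq.decodeK map_id.
Qed.

Lemma cfun_code (G : countType) (a : G -> seq nat) :
  cfun a -> cfun (fun g => CodeSeq.code (a g)).
Proof. by apply: cfun_same_code => s; rewrite pickle_seqE map_id. Qed.

(* Dispatch is syntactic: unification would unfold the pickling of [nat]. *)
Ltac cfun_step := first [ exact: cfun_const | exact: cfun_id | assumption |
  lazymatch goal with
  | |- cfun (fun g => (@?a g, @?b g)) => apply: cfun_pair
  | |- cfun fst => exact: (cfun_fst cfun_id)
  | |- cfun snd => exact: (cfun_snd cfun_id)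
  | |- cfun S => exact: (cfun_nat1 computable_succ cfun_id)
  | |- cfun size => exact: (cfun_size cfun_id)
  | |- cfun (fun g => (@?a g).1) => apply: cfun_fst
  | |- cfun (fun g => (@?a g).2) => apply: cfun_snd
  | |- cfun (fun g => @?a g && @?b g) => apply: cfun_and
  | |- cfun (fun g => @?a g || @?b g) => apply: cfun_or
  | |- cfun (fun g => ~~ @?a g) => apply: cfun_neg
  | |- cfun (fun g => @?a g == @?b g) => apply: cfun_eq
  | |- cfun (fun g => @?a g <= @?b g) => apply: cfun_leq
  | |- cfun (fun g => (@?a g).+1) => apply: (cfun_nat1 computable_succ)
  | |- cfun (fun g => @?a g + @?b g) => apply: (cfun_nat2 computable_add)
  | |- cfun (fun g => @?a g * @?b g) => apply: (cfun_nat2 computable_mul)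
  | |- cfun (fun g => @?a g - @?b g) => apply: (cfun_nat2 computable_sub)
  | |- cfun (fun g => @?a g ^ @?b g) => apply: (cfun_nat2 computable_exp)
  | |- cfun (fun g => head 0 (@?a g)) => apply: cfun_head
  | |- cfun (fun g => behead (@?a g)) => apply: cfun_behead
  | |- cfun (fun g => @?a g :: @?b g) => apply: cfun_cons
  | |- cfun (fun g => nth _ (@?a g) (@?b g)) => apply: cfun_nth
  | |- cfun (fun g => size (@?a g)) => apply: cfun_size
  | |- cfun (fun g => drop (@?a g) (@?b g)) => apply: cfun_drop
  | |- cfun (fun g => CodeSeq.code (@?a g)) => apply: cfun_code
  | |- cfun (fun g => CodeSeq.decode (@?a g)) => apply: cfun_decode
  | |- cfun (fun g => pickle (@?a g)) => apply: cfun_pickle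
  end ].

Ltac cfun_tac := repeat cfun_step.

(** * Semidecidable predicates *)

Lemma eq_semidec (G : countType) (P Q : G -> Prop) :
  (forall g, P g <-> Q g) -> semidec P -> semidec Q.
Proof. by move=> PQ [F cF FP]; exists F => // g; rewrite -FP PQ. Qed.

Section Semidecidable.
Context {G : countType}.
Implicit Types (g : G) (P Q : G -> Prop).

Lemma semidec_bool (p : G -> bool) : cfun p -> semidec p.
Proof.
move=> [F cF FP]; exists (fun xs => 1 - F [:: nth 0 xs 1]).
  apply: computable_sub (computable_const _) _.
  exact: computable_comp1 cF (computable_nth _).
move=> g; split=> [pg|[k]]; first by exists 0; rewrite /= FP pg.
by rewrite /= FP; case: (p g).
Qed.

Lemma semidec_eq (T : countType) (a b : G -> T) :
  cfun a -> cfun b -> semidec (fun g => a g = b g).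
Proof.
move=> ca cb; apply: eq_semidec (semidec_bool (cfun_eq ca cb)) => g.
by split=> /eqP.
Qed.

(** One stage has to witness both conjuncts, so it is read as the code of a pair of stages. *)
Lemma semidec_and P Q :
  semidec P -> semidec Q -> semidec (fun g => P g /\ Q g).
Proof.
move=> [A cA AP] [B cB BP].
exists (fun xs => A [:: nth_code (nth 0 xs 0) 0; nth 0 xs 1]
                + B [:: nth_code (nth 0 xs 0) 1; nth 0 xs 1]).
  by apply: computable_add; apply: computable_comp2 => //;
    [apply: computable_nth_code|..|apply: computable_nth_code|];
    (exact: computable_nth || exact: computable_const).
move=> g; rewrite AP BP; split=> [[[k k0] [l l0]]|[k /= /eqP]].
  exists (pair_code k l); rewrite [nth 0 (_ :: _) 0]/= [nth 0 (_ :: _) 1]/=.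
  by rewrite nth_pair_code nth_pair_code0 k0 l0.
by rewrite addn_eq0 => /andP[/eqP ? /eqP ?]; split; eexists; eauto.
Qed.

Lemma semidec_or P Q :
  semidec P -> semidec Q -> semidec (fun g => P g \/ Q g).
Proof.
move=> [A cA AP] [B cB BP].
exists (fun xs => A [:: nth 0 xs 0; nth 0 xs 1] * B [:: nth 0 xs 0; nth 0 xs 1]).
  by apply: computable_mul; apply: computable_comp2 => //; exact: computable_nth.
move=> g; rewrite AP BP; split=> [[|] [k k0]|[k /= /eqP]].
- by exists k; rewrite /= k0.
- by exists k; rewrite /= k0 muln0.
by rewrite muln_eq0 => /orP[] /eqP ?; [left|right]; exists k.
Qed.

Lemma semidec_ex (T : countType) (P : G -> T -> Prop) : effective T ->
  semidec (fun p : G * T => P p.1 p.2) -> semidec (fun g => exists x, P g x).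
Proof.
move=> [R cR RP] [F cF FP].
pose K (xs : seq nat) i := nth_code (nth 0 xs 0) i.
have cK i : computable (K^~ i).
  exact: computable_nth_code (computable_nth _) (computable_const _).
(* The stage codes a triple: a stage showing that the second entry is the code of an element of [T],
   this code itself, and a stage for [P] at that element. *)
exists (fun xs => R [:: K xs 0; K xs 1]
                + F [:: K xs 2; pair_code (nth 0 xs 1) (K xs 1)]).
  apply: computable_add; first exact: computable_comp2.
  by apply: computable_comp2 => //; apply: computable_pair (computable_nth _) (cK _).
move=> g; split=> [[x /(FP (g, x))[k k0]]|[k /= /eqP]].
  have [k' k'0] : exists k', R [:: k'; pickle x] = 0 by apply/RP; exists x.
  exists (CodeSeq.code [:: k'; pickle x; k]).
  have KE s l i : K (CodeSeq.code s :: l) i = nth 0 s i.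
    by congr (nth 0 _ _); exact: CodeSeq.codeK.
  by rewrite !KE k'0 add0n [nth 0 (_ :: _) 1]/= -pickle_pair.
rewrite addn_eq0 => /andP[/eqP Rk /eqP Fk].
have [x px] : exists x : T, pickle x = K [:: k] 1 by apply/RP; exists (K [:: k] 0).
by exists x; apply/(FP (g, x)); exists (K [:: k] 2); rewrite pickle_pair px.
Qed.

End Semidecidable.

Lemma semidec_comp (G T : countType) (P : T -> Prop) (a : G -> T) :
  semidec P -> cfun a -> semidec (fun g => P (a g)).
Proof.
move=> [F cF FP] [A cA AP]; exists (fun xs => F [:: nth 0 xs 0; A [:: nth 0 xs 1]]).
  apply: computable_comp2 => //; first exact: computable_nth.
  exact: computable_comp1 cA (computable_nth _).
by move=> g; rewrite FP; split=> -[k /= k0]; exists k; rewrite /= AP in k0 *.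
Qed.

Lemma semidec_comp2 (G T U : countType) (P : T -> U -> Prop) (a : G -> T)
    (b : G -> U) :
  semidec (fun z : T * U => P z.1 z.2) -> cfun a -> cfun b ->
  semidec (fun g => P (a g) (b g)).
Proof.
move=> cP ca cb; exact: (semidec_comp (a := fun g => (a g, b g)) cP (cfun_pair ca cb)).
Qed.

(** Acceptance at a given stage is decidable and can therefore be negated. It need not persist at
    later stages, which is why later conditions ask for some k below a bound. *)
Lemma semidec_stages (T : countType) (P : T -> Prop) : semidec P ->
  exists2 p : nat * T -> bool, cfun p & forall x, P x <-> exists k, p (k, x).
Proof.
move=> [F cF FP]; exists (fun z => F [:: z.1; pickle z.2] == 0).
  apply: cfun_eq (cfun_const _).
  exists (fun xs => F [:: head_code (nth 0 xs 0); nth_code (nth 0 xs 0) 1]).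
    apply: computable_comp2 => //; first exact: computable_head (computable_nth _).
    exact: computable_nth_code (computable_nth _) (computable_const _).
  by move=> [k x]; rewrite /= pickle_pair head_pair_code nth_pair_code.
by move=> x; rewrite FP; split=> -[k]; [move=> k0 | move=> /eqP k0]; exists k => //; apply/eqP.
Qed.

Lemma effective_nat : effective nat.
Proof.
by exists (fun=> 0); [exact: computable_zero | move=> n; split=> _; [exists 0 | exists n]].
Qed.

Lemma semidec_ball (G : countType) (n : G -> nat) (P : nat -> G -> Prop) :
  cfun n -> semidec (fun z : nat * G => P z.1 z.2) ->
  semidec (fun g => forall m, m < n g -> P m g).
Proof.
move=> cn /semidec_stages[p cp pP].
(* [K] is a common bound on the stages at which the instances are accepted. *)
pose q (K : nat) (g : G) := all (fun m =>
  ~~ all (fun k => ~~ p (k, (m, g))) (iota 0 K)) (iota 0 (n g)).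
apply: (@eq_semidec _ (fun g => exists K, q K g)) => [g|].
  split=> [[K /allP qK] m m_n|nP].
    have := qK m; rewrite mem_iota => /(_ m_n); rewrite -has_predC.
    by case/hasP => k _ /negPn pk; apply/(pP (m, g)); exists k.
  have /choice[f fP] : forall m, exists k, m < n g -> p (k, (m, g)).
    move=> m; have [m_n|_] := boolP (m < n g); last by exists 0.
    by have /(pP (m, g))[k pk] := nP _ m_n; exists k.
  exists (\max_(m < n g) f m).+1; apply/allP => m; rewrite mem_iota => /andP[_].
  rewrite add0n => m_n; rewrite -has_predC; apply/hasP; exists (f m).
    by rewrite mem_iota /= add0n ltnS (leq_bigmax (Ordinal m_n)).
  by rewrite /= negbK fP.
apply: (semidec_ex effective_nat); apply: semidec_bool; rewrite /q.
apply: (cfun_ball (n := fun z : G * nat => n z.1)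
  (p := fun m z => ~~ all (fun k => ~~ p (k, (m, z.1))) (iota 0 z.2))).
  exact: cfun_comp cn (cfun_fst cfun_id).
apply: cfun_neg; apply: (cfun_ball (n := fun z : nat * (G * nat) => z.2.2)
  (p := fun k z => ~~ p (k, (z.1, z.2.1)))); first by cfun_tac.
apply: cfun_neg; apply: (cfun_comp cp); cfun_tac.
Qed.

Lemma effective_bool : effective bool.
Proof.
apply: (@eq_semidec _ (fun n => n <= 1)).
  move=> n; split=> [|[[] <-]//].
  by case: n => [|[|]]//; [exists false|exists true].
by apply: semidec_bool; cfun_tac.
Qed.

Existing Class effective.
Existing Instance effective_nat.
Existing Instance effective_bool.

Ltac semidec_step := lazymatch goal with
  | |- semidec (fun g => exists x, @?P g x) =>
      apply: (@semidec_ex _ _ P); cbv beta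
  | |- semidec (fun g => _ /\ _) => apply: semidec_and
  | |- semidec (fun g => _ \/ _) => apply: semidec_or
  | |- semidec (fun g => @?a g = @?b g) => apply: semidec_eq
  | |- semidec (fun g => is_true (@?a g)) => apply: semidec_bool
  | |- semidec (fun g => forall m, is_true (m < @?n g) -> @?P m g) =>
      apply: (@semidec_ball _ n P); [| cbv beta]
  end.

#[global] Instance effective_pair (T U : countType) :
  effective T -> effective U -> effective (T * U)%type.
Proof.
move=> eT eU; apply: (@eq_semidec _ (fun n : nat => exists a b : nat,
  (exists x : T, pickle x = a) /\ (exists y : U, pickle y = b) /\
  n = pair_code a b)).
  move=> n; split=> [[a [b [[x <-] [[y <-] ->]]]]|[[x y] <-]]; first by exists (x, y).
  by exists (pickle x), (pickle y); split; [exists x | split=> //; exists y].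
do 2!semidec_step; apply: semidec_and; last apply: semidec_and.
- by apply: (semidec_comp eT); cfun_tac.
- by apply: (semidec_comp eU); cfun_tac.
- by apply: semidec_eq; last apply: (cfun_nat2 computable_pair); cfun_tac.
Qed.

(** Every number is the code of a list of numbers, so only the entries have to be tested. *)
#[global] Instance effective_seq (T : countType) :
  effective T -> effective (seq T).
Proof.
move=> eT; apply: (@eq_semidec _ (fun n : nat => forall i,
    i < size (CodeSeq.decode n) -> exists x : T, pickle x = nth 0 (CodeSeq.decode n) i)).
  move=> n; split=> [nP|[s <-] i]; last first.
    rewrite pickle_seqE CodeSeq.codeK size_map => i_s.
    by case: s i_s => // x s i_s; exists (nth x (x :: s) i); rewrite (nth_map x).
  suff [s sE] : exists s : seq T, map pickle s = CodeSeq.decode n.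
    by exists s; rewrite pickle_seqE sE CodeSeq.decodeK.
  elim: (CodeSeq.decode n) nP => [|k l IHl] lP; first by exists [::].
  have [x /= <-] := lP 0 isT.
  have [i i_l|s <-] := IHl; first exact: (lP i.+1).
  by exists (x :: s).
apply: semidec_ball.
  by apply: cfun_size; apply: cfun_decode; exact: cfun_id.
by apply: (semidec_comp eT); apply: cfun_nth; last cfun_tac; apply: cfun_decode; cfun_tac.
Qed.

Lemma mem_dropP (T : eqType) (s : seq T) (x : T) :
  x \in s <-> exists i t, drop i s = x :: t.
Proof.
split=> [x_s|[i [t sE]]].
  exists (index x s), (drop (index x s).+1 s).
  by rewrite (drop_nth x) ?index_mem// nth_index.
by apply: (@mem_drop i); rewrite sE mem_head.
Qed.

Lemma semidec_mem (G T : countType) (a : G -> T) (s : G -> seq T) :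
  effective T -> cfun a -> cfun s -> semidec (fun g => a g \in s g).
Proof.
move=> eT ca cs; apply: (@eq_semidec _ (fun g => exists i t, drop i (s g) = a g :: t)).
  by move=> g; rewrite mem_dropP.
have cfa (H : countType) (h : H -> G) : cfun h -> cfun (fun g => a (h g)) by exact: cfun_comp.
have cfs (H : countType) (h : H -> G) : cfun h -> cfun (fun g => s (h g)) by exact: cfun_comp.
by do 3!semidec_step; cfun_tac; do ?[apply: cfa | apply: cfs]; cfun_tac.
Qed.

Ltac semidec_tac := repeat (cfun_step || lazymatch goal with
  | |- semidec (fun g => is_true (_ \in _)) => apply: semidec_mem
  | _ => semidec_step
  end).

Lemma semidec_all (G T : countType) (s : G -> seq T) (P : T -> G -> Prop) :
  effective T -> cfun s -> semidec (fun z : T * G => P z.1 z.2) ->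
  semidec (fun g => forall x, x \in s g -> P x g).
Proof.
move=> eT cs cP; apply: (@eq_semidec _ (fun g => forall i, i < size (s g) ->
    exists x t, drop i (s g) = x :: t /\ P x g)) => [g|].
  split=> [sP x x_s|sP i i_s].
    have := sP (index x (s g)); rewrite index_mem x_s => /(_ isT)[y [t []]].
    by rewrite (drop_nth x) ?index_mem// nth_index// => -[<- _].
  case: (s g) i_s sP => // x0 s0 i_s sP.
  exists (nth x0 (x0 :: s0) i), (drop i.+1 (x0 :: s0)).
  by rewrite -drop_nth//; split=> //; apply/sP/mem_nth.
have cfs (H : countType) (h : H -> G) : cfun h -> cfun (fun g => s (h g)) by exact: cfun_comp.
apply: semidec_ball; [exact: cfun_size | do 3!semidec_step].
  by apply: semidec_eq; cfun_tac; do ?apply: cfs; cfun_tac.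
by apply: (semidec_comp2 cP); cfun_tac.
Qed.

(* Unbounded search for the value together with a witness that it is the value.
   Surjectivity of the coding of G makes the search total. *)
Lemma cfun_graph (G T : countType) (f : G -> T) : effective T ->
  (forall n, exists g : G, pickle g = n) ->
  semidec (fun z : T * G => z.1 = f z.2) -> cfun f.
Proof.
move=> [R cR RP] sG [F cF FP].
pose K (xs : seq nat) i := nth_code (nth 0 xs 0) i.
have cK i : computable (K^~ i).
  exact: computable_nth_code (computable_nth _) (computable_const _).
pose D (xs : seq nat) := R [:: K xs 0; K xs 1] + F [:: K xs 2; pair_code (K xs 1) (nth 0 xs 1)].
have cD : computable D.
  apply: computable_add; first exact: computable_comp2.
  by apply: computable_comp2 => //; apply: computable_pair (cK _) (computable_nth _).
have KE s l i : K (CodeSeq.code s :: l) i = nth 0 s i.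
  by congr (nth 0 _ _); exact: CodeSeq.codeK.
have exD xs : exists k, D (k :: xs) == 0.
  have [g gx] := sG (nth 0 xs 0).
  have [k0 k00] : exists k, R [:: k; pickle (f g)] = 0 by apply/RP; exists (f g).
  have /(FP (f g, g))[k1 k10] : f g = f g by [].
  exists (CodeSeq.code [:: k0; pickle (f g); k1]).
  by rewrite /D !KE k00 [nth 0 (_ :: _) 1]/= [nth 0 (_ :: _) 1]/= -gx -pickle_pair k10.
exists (fun xs => K [:: ex_minn (exD xs)] 1).
  exact: computable_nth_code (computable_min exD cD) (computable_const _).
move=> g; case: ex_minnP => k; rewrite addn_eq0 => /andP[/eqP Rk /eqP Fk] _.
have [x px] : exists x : T, pickle x = K [:: k] 1 by apply/RP; exists (K [:: k] 0).
rewrite -px; congr pickle; apply/(FP (x, g)).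
by exists (K [:: k] 2); rewrite pickle_pair px.
Qed.

(** * Enumerable sets and their universal enumeration *)

(** The enumerating program may diverge, which also covers the empty set. It reads its input as a
    pair (k, n) and minimizes a function of y that vanishes only if y = n and n is accepted at stage
    k: the output is n if stage k accepts n, and otherwise the search never ends. *)
Lemma semidec_enumerable (T : countType) (A : T -> Prop) :
  effective T -> semidec A -> enumerable (A : set T).
Proof.
move=> eT sA.
have sB : semidec (fun n : nat => exists x : T, pickle x = n /\ A x).
  semidec_step; apply: semidec_and; last by apply: (semidec_comp sA); cfun_tac.
  by apply: semidec_eq; [apply: cfun_pickle|]; cfun_tac.
have [p [P cP PE] pP] := semidec_stages sB.
pose c (xs : seq nat) := nth 0 xs 1.
have cc : computable c by exact: computable_nth.
pose m xs := nth_code (c xs) 1.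
have cm : computable m by exact: computable_nth_code (computable_const _).
pose G (xs : seq nat) := (1 - P [:: pair_code (head_code (c xs)) (m xs)])
  + ((m xs - nth 0 xs 0) + (nth 0 xs 0 - m xs)).
have [g gP] : computable G.
  apply: computable_add; last first.
    by apply: computable_add; apply: computable_sub => //; exact: computable_nth.
  apply: (computable_sub (computable_const _)); apply: (computable_comp1 cP).
  by apply: computable_pair => //; exact: computable_head.
have GE y k n : G [:: y; pair_code k n] = 0 <-> p (k, n) /\ y = n.
  rewrite /G /m /c [nth 0 _ 1]/= [nth 0 _ 0]/= head_pair_code nth_pair_code.
  rewrite -[pair_code k n]/(pickle (k, n)) PE; case: (p (k, n)) => /=; last by split=> -[].
  by change (pickle true) with 1; split=> [|[_ ->]]; lia.
have GE' y x : G [:: y; x] = 0 -> exists k, p (k, y).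
  set k := head_code x; set n := nth_code x 1 => G0.
  have /GE[pkn ->] : G [:: y; pair_code k n] = 0.
    rewrite -G0 /G /m /c [nth 0 _ 1]/= [nth 0 _ 0]/= [nth 0 [:: _; x] 1]/=.
    by rewrite head_pair_code nth_pair_code.
  by exists k.
exists (RMin g); apply/seteqP; split=> n.
  move=> [x Ax <-]; have /pP[k pk] : exists x' : T, pickle x' = pickle x /\ A x' by exists x.
  exists (pair_code k (pickle x)); split.
    by apply/gP; apply/esym/GE.
  move=> j lt_j; exists (G [:: j; pair_code k (pickle x)]).-1; apply/gP.
  rewrite prednK// lt0n; apply/eqP => /GE[_ jE].
  by rewrite jE ltnn in lt_j.
move=> [x [/gP/esym/GE'[k pk] _]].
have [|y [yn Ay]] := (pP n).2; first by exists k.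
by exists y.
Qed.

(** * Derivations as finite witnesses of computations *)

Section RecfunInd.
Context (P : recfun -> Prop) (PZero : P RZero) (PSucc : P RSucc).
Context (PProj : forall i, P (RProj i)).
Context (PComp : forall g hs, P g ->
  (forall i, i < size hs -> P (nth RZero hs i)) -> P (RComp g hs)).
Context (PRec : forall g h, P g -> P h -> P (RRec g h)).
Context (PMin : forall g, P g -> P (RMin g)).

(** [RComp] nests programs inside a list, and its case requires a hypothesis for every entry of that
    list. *)
Fixpoint recfun_nested_ind f : P f.
Proof.
case: f => [|||g hs|g h|g].
- exact: PZero.
- exact: PSucc.
- exact: PProj.
- apply: PComp; first exact: recfun_nested_ind.
  elim: hs => [|h hs IHhs] i lt_i; first by exfalso; rewrite ltn0 in lt_i.
  case: i lt_i => [_|i]; [exact: (recfun_nested_ind h) | exact: IHhs].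
- by apply: PRec; exact: recfun_nested_ind.
- by apply: PMin; exact: recfun_nested_ind.
Qed.
End RecfunInd.

Lemma computes_RComp g hs xs y : computes (RComp g hs) xs y <->
  exists ys, [/\ size ys = size hs,
    forall i, i < size hs -> computes (nth RZero hs i) xs (nth 0 ys i) &
    computes g ys y].
Proof.
have argsP : forall ys,
    (fix all_compute (hs : seq recfun) (ys : seq nat) {struct hs} : Prop :=
         match hs, ys with
         | [::], [::] => True
         | h :: hs', z :: ys' => computes h xs z /\ all_compute hs' ys'
         | _, _ => False
         end) hs ys <->
    size ys = size hs /\
    forall i, i < size hs -> computes (nth RZero hs i) xs (nth 0 ys i).
  elim: hs => [|h hs IHhs] [|z ys] //=; try by [split | split=> -[]].
  rewrite IHhs; split=> [[hz [-> hsP]]|[[ys_hs] hsP]].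
    by split=> // -[|i] /=; last exact: hsP.
  by split; [exact: (hsP 0) | split=> // i; exact: (hsP i.+1)].
split=> [[ys /argsP[ys_hs hsP] gy]|[ys [ys_hs hsP gy]]]; first by exists ys.
by exists ys => //; apply/argsP.
Qed.

Fixpoint recfun_code (f : recfun) : nat :=
  match f with
  | RZero => CodeSeq.code [:: 0]
  | RSucc => CodeSeq.code [:: 1]
  | RProj i => CodeSeq.code [:: 2; i]
  | RComp g hs =>
      CodeSeq.code [:: 3; recfun_code g; CodeSeq.code (map recfun_code hs)]
  | RRec g h => CodeSeq.code [:: 4; recfun_code g; recfun_code h]
  | RMin g => CodeSeq.code [:: 5; recfun_code g]
  end.

(* [(e, xs, y)] reads: the program with code e maps xs to y. *)
Definition justified (D : seq (nat * seq nat * nat)) (e : nat) (xs : seq nat)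
    (y : nat) : Prop :=
  (e = CodeSeq.code [:: 0] /\ y = 0) \/
  (e = CodeSeq.code [:: 1] /\ y = (nth 0 xs 0).+1) \/
  (exists i, e = CodeSeq.code [:: 2; i] /\ y = nth 0 xs i) \/
  (exists g hs ys, e = CodeSeq.code [:: 3; g; CodeSeq.code hs] /\
    (size ys = size hs /\
    ((forall j, j < size hs -> (nth 0 hs j, xs, nth 0 ys j) \in D) /\
    (g, ys, y) \in D))) \/
  (exists g h, e = CodeSeq.code [:: 4; g; h] /\
    ((head 0 xs = 0 /\ (g, behead xs, y) \in D) \/
     exists m r, head 0 xs = m.+1 /\
       ((e, m :: behead xs, r) \in D /\ (h, [:: m, r & behead xs], y) \in D))) \/
  (exists g, e = CodeSeq.code [:: 5; g] /\
    ((g, y :: xs, 0) \in D /\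
    forall m, m < y -> exists k, (g, m :: xs, k.+1) \in D)).

(** Premises stand to the right of the conclusion, so that a new step is added by a cons and
    circular justifications are excluded. *)
Fixpoint derivation (D : seq (nat * seq nat * nat)) : Prop :=
  if D is (e, xs, y) :: D' then justified D' e xs y /\ derivation D' else True.

Lemma code_inj : injective CodeSeq.code.
Proof. exact: can_inj CodeSeq.codeK. Qed.

Definition recfun_args f : seq nat :=
  match f with
  | RZero => [:: 0]
  | RSucc => [:: 1]
  | RProj i => [:: 2; i]
  | RComp g hs => [:: 3; recfun_code g; CodeSeq.code (map recfun_code hs)]
  | RRec g h => [:: 4; recfun_code g; recfun_code h]
  | RMin g => [:: 5; recfun_code g]
  end.

Lemma recfun_codeE f : recfun_code f = CodeSeq.code (recfun_args f).
Proof. by case: f. Qed.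

Lemma derivation_sound D f xs y :
  derivation D -> (recfun_code f, xs, y) \in D -> computes f xs y.
Proof.
elim: D f xs y => [//|[[e xs'] y'] D IHD] f xs y /= [just dD].
rewrite inE => /orP[/eqP E|]; last exact: IHD.
case: E just => <- <- <-.
have {}IHD f' xs1 y1 e1 : e1 = recfun_code f' -> (e1, xs1, y1) \in D ->
  computes f' xs1 y1 by move=> ->; exact: IHD.
rewrite /justified recfun_codeE.
case=> [[/code_inj + ->]|]; first by case: f.
case=> [[/code_inj + ->]|]; first by case: f.
case=> [[i [/code_inj + ->]]|]; first by case: f => //= j [->].
case=> [[g' [hs' [ys [/code_inj + [ys_hs [hsD gD]]]]]]|].
  case: f => // g hs [gE /code_inj hsE]; subst g' hs'.
  apply/computes_RComp; exists ys; split; last by exact: IHD gD.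
    by rewrite ys_hs size_map.
  move=> i i_hs; apply: IHD (hsD i _); last by rewrite size_map.
  by rewrite (nth_map RZero).
case=> [[g' [h' [+ J]]]|].
  rewrite -recfun_codeE in J *; move=> fE.
  case: J => [[xs0 gD]|[m [r [xsm [fD hD]]]]].
    move: fE; rewrite recfun_codeE => /code_inj; case: f => // g h [gE hE].
    by rewrite /= xs0; apply: IHD gD.
  (* One premise of a recursion step carries the code of the whole program, so the induction
     hypothesis is applied to [f] before [f] is taken apart. *)
  have /= := IHD _ _ _ _ erefl fD.
  move: fE; rewrite recfun_codeE => /code_inj; case: f {fD} => // g h [gE hE].
  by rewrite /= xsm => fr; exists r => //; apply: IHD hD.
move=> [g' [/code_inj + [gD gD']]]; case: f => //= g [gE].
split; first exact: IHD gD.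
by move=> m /gD'[k kD]; exists k; apply: IHD kD.
Qed.

Lemma justified_sub D D' e xs y :
  {subset D <= D'} -> justified D e xs y -> justified D' e xs y.
Proof.
move=> DD'; rewrite /justified.
case=> [?|]; first by left.
case=> [?|]; first by right; left.
case=> [?|]; first by do 2!right; left.
case=> [[g [hs [ys [eE [ys_hs [hsD gD]]]]]]|].
  do 3!right; left; exists g, hs, ys; split=> //; split=> //; split; last exact: DD' gD.
  by move=> j j_hs; apply/DD'/hsD.
case=> [[g [h [eE J]]]|[g [eE [gD mD]]]].
  do 4!right; left; exists g, h; split=> //.
  case: J => [[xs0 gD]|[m [r [xsm [fD hD]]]]]; [left|right].
    by split=> //; exact: DD'.
  by exists m, r; split=> //; split; exact: DD'.
do 5!right; exists g; split=> //; split; first exact: DD'.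
by move=> m /mD[k kD]; exists k; exact: DD'.
Qed.

Lemma derivation_cat D D' : derivation D -> derivation D' -> derivation (D ++ D').
Proof.
elim: D => [//|[[e xs] y] D IHD] /= [just dD] dD'; split; last exact: IHD.
by apply: justified_sub just => p pD; rewrite mem_cat pD.
Qed.

Definition derivable p := exists2 D, derivation D & p \in D.

(** Derivations can be concatenated, because [justified] is monotone in the set of premises; this
    collects the finitely many premises of a composition or of a minimization. *)
Lemma derivable_and (n : nat) (p : nat -> nat * seq nat * nat) D :
  derivation D -> (forall i, i < n -> derivable (p i)) ->
  exists D', [/\ derivation D', {subset D <= D'} & forall i, i < n -> p i \in D'].
Proof.
move=> dD; elim: n => [|n IHn] pD; first by exists D; split.
have [D1 [dD1 DD1 pD1]] := IHn (fun i i_n => pD i (leqW i_n)).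
have [D2 dD2 pD2] := pD n (ltnSn n).
exists (D1 ++ D2); split; first exact: derivation_cat.
  by move=> q /DD1 qD1; rewrite mem_cat qD1.
move=> i; rewrite ltnS leq_eqVlt mem_cat => /orP[/eqP->|/pD1 ->//].
by rewrite pD2 orbT.
Qed.

Lemma derivable_step D e xs y : derivation D -> justified D e xs y ->
  derivable (e, xs, y).
Proof. by move=> dD just; exists ((e, xs, y) :: D) => //; rewrite inE eqxx. Qed.

Lemma computes_derivable f xs y :
  computes f xs y -> derivable (recfun_code f, xs, y).
Proof.
elim/recfun_nested_ind: f xs y => [||i|g hs IHg IHhs|g h IHg IHh|g IHg] xs y.
- by move=> ->; apply: (@derivable_step [::]) => //; left.
- by move=> ->; apply: (@derivable_step [::]) => //; right; left.
- by move=> ->; apply: (@derivable_step [::]) => //; do 2!right; left; exists i.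
- move=> /computes_RComp[ys [ys_hs hsP /IHg[D dD gD]]].
  have [i i_hs|D' [dD' DD' hsD]] := @derivable_and (size hs)
    (fun i => (nth 0 (map recfun_code hs) i, xs, nth 0 ys i)) _ dD.
    by rewrite (nth_map RZero)//; apply: IHhs => //; exact: hsP.
  apply: derivable_step dD' _; do 3!right; left.
  exists (recfun_code g), (map recfun_code hs), ys; rewrite size_map; split=> //.
  by split=> //; split=> //; exact: DD'.
- rewrite /=; move nE : (head 0 xs) => n.
  (* The trivial equation lets the induction generalize the tail to [t], so that its hypothesis
     applies to [n :: behead xs], a list with the same tail and a smaller head. *)
  have {nE} nE : head 0 xs = n /\ behead xs = behead xs by [].
  elim: n xs y {2 3}(behead xs) nE => [|n IHn] xs y t [xs0 tE].
    rewrite -tE => /IHg[D dD gD]; apply: derivable_step dD _.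
    by do 4!right; left; exists (recfun_code g), (recfun_code h); split=> //; left.
  rewrite -tE => -[r /(IHn (n :: behead xs) _ _ (conj erefl erefl))[D1 dD1 fD]].
  move=> /IHh[D2 dD2 hD]; apply: (derivable_step (derivation_cat dD1 dD2)).
  do 4!right; left; exists (recfun_code g), (recfun_code h); split=> //; right.
  by exists n, r; rewrite !mem_cat fD hD orbT.
move=> /= [/IHg[D dD gD] mP].
have /choice[k kP] : forall m, exists k, m < y -> computes g (m :: xs) k.+1.
  move=> m; have [/mP[k gk]|_] := boolP (m < y); first by exists k.
  by exists 0.
have [m m_y|D' [dD' DD' mD]] := @derivable_and y
  (fun m => (recfun_code g, m :: xs, (k m).+1)) _ dD; first exact/IHg/kP.
apply: derivable_step dD' _; do 5!right; exists (recfun_code g); split=> //.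
by split=> [|m m_y]; [exact: DD' | exists (k m); exact: mD].
Qed.

(** Replaces recursion on the list by a bounded quantifier over positions, to which the closure
    rules of [semidec] apply. *)
Lemma derivationP D : derivation D <-> forall i, i < size D ->
  exists e xs y t, drop i D = (e, xs, y) :: t /\ justified t e xs y.
Proof.
elim: D => [//|[[e xs] y] D IHD]; split=> [/= [just /IHD dD] [_|i /dD//]|dD].
  by exists e, xs, y, D.
split; last by apply/IHD => i i_D; exact: (dD i.+1).
by have [e' [xs' [y' [t [[-> -> -> ->]]]]]] := dD 0 isT.
Qed.

(* The parametrization of the enumerable sets by (codes of) programs; a number
   that is not a code of a program also yields some set. *)
Definition outputs (e m : nat) : Prop :=
  exists k D, derivation D /\ (e, [:: k], m) \in D.

Lemma semidec_justified :
  semidec (fun z : seq (nat * seq nat * nat) * (nat * (seq nat * nat)) =>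
    justified z.1 z.2.1 z.2.2.1 z.2.2.2).
Proof. by rewrite /justified; semidec_tac. Qed.

Lemma semidec_outputs : semidec (fun z : nat * nat => outputs z.1 z.2).
Proof.
have sJ : semidec derivation.
  apply: eq_semidec (fun D => iff_sym (derivationP D)) _.
  semidec_tac.
  apply: (semidec_comp (a := fun z => (_, (_, (_, _)))) semidec_justified).
  by cfun_tac.
rewrite /outputs; semidec_tac.
by apply: (semidec_comp sJ); cfun_tac.
Qed.

Lemma enumerable_outputs (T : countType) (A : set T) : enumerable A ->
  exists e, forall m, outputs e m <-> exists2 x, A x & pickle x = m.
Proof.
move=> [f fP]; exists (recfun_code f) => m.
have -> : (exists2 x, A x & pickle x = m) <-> exists k, computes f [:: k] m.
  by move: fP => /seteqP[fA Af]; split=> [|[k kP]]; [exact: fA | apply: Af; exists k].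
split=> [[k [D [dD mD]]]|[k /computes_derivable[D dD mD]]].
  by exists k; exact: derivation_sound mD.
by exists k, D.
Qed.

(** The enumerating program may be partial, but each of its outputs is witnessed by a derivation,
    for which one can search. *)
Lemma enumerable_semidec (T : countType) (A : set T) : enumerable A -> semidec A.
Proof.
move=> /enumerable_outputs[e eP]; apply: (@eq_semidec _ (fun x => outputs e (pickle x))).
  move=> x; rewrite eP; split=> [[y Ay /pickle_inj <-//]|Ax]; by exists x.
apply: (semidec_comp2 semidec_outputs); last apply: cfun_pickle; cfun_tac.
Qed.

(** * Rational arithmetic *)

(** Mirrors the coding of integers: the number stays the same, while sign and absolute value become
    accessible to list operations. *)
Definition int_parts (z : int) : seq nat * seq nat :=
  match z with Posz n => ([:: n], [::]) | Negz n => ([::], [:: n]) end.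

Lemma pickle_int_parts z : pickle (int_parts z) = pickle z.
Proof. by case: z. Qed.

Definition num_pos (q : rat) := nth 0 (int_parts (valq q).1).1 0.
(** [Negz n] stands for -(n + 1): [size s] supplies the 1, and both terms vanish for a nonnegative
    numerator. *)
Definition num_neg (q : rat) :=
  let s := (int_parts (valq q).1).2 in size s + nth 0 s 0.
Definition den (q : rat) := nth 0 (int_parts (valq q).2).1 0.

Section RatParts.
Context {G : countType}.
Implicit Types a b : G -> rat.

Lemma cfun_int_parts (a : G -> int) : cfun a -> cfun (fun g => int_parts (a g)).
Proof. exact: cfun_same_code pickle_int_parts. Qed.

Lemma cfun_valq a : cfun a -> cfun (fun g => valq (a g)).
Proof. exact: cfun_same_code. Qed.

Lemma cfun_num_pos a : cfun a -> cfun (fun g => num_pos (a g)).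
Proof.
move=> ca; apply: cfun_nth; last exact: cfun_const.
exact/cfun_fst/cfun_int_parts/cfun_fst/cfun_valq.
Qed.

Lemma cfun_num_neg a : cfun a -> cfun (fun g => num_neg (a g)).
Proof.
move=> ca; have cs : cfun (fun g => (int_parts (valq (a g)).1).2).
  exact/cfun_snd/cfun_int_parts/cfun_fst/cfun_valq.
by apply: (cfun_nat2 computable_add); cfun_tac.
Qed.

Lemma cfun_den a : cfun a -> cfun (fun g => den (a g)).
Proof.
move=> ca; apply: cfun_nth; last exact: cfun_const.
exact/cfun_fst/cfun_int_parts/cfun_snd/cfun_valq.
Qed.

End RatParts.

Lemma den_gt0 q : 0 < den q.
Proof. by rewrite /den -/(denq q); case: (denq q) (denq_gt0 q). Qed.

Lemma ratE q : q = (((num_pos q)%:R - (num_neg q)%:R) / (den q)%:R :> rat)%R.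
Proof.
rewrite -[LHS]divq_num_den; congr (_ / _)%R.
  rewrite /num_pos /num_neg -/(numq q); case: (numq q) => n /=.
    by rewrite subr0.
  by rewrite NegzE add1n sub0r rmorphN.
by rewrite /den -/(denq q); have := denq_gt0 q; case: (denq q).
Qed.

(** The codes are those of reduced fractions. Coprimality of a and d > 0 is recognized by a search
    for u and v with u d = v a + 1; the second alternative has [a.+1], the absolute value of
    [Negz a]. *)
#[global] Instance effective_rat : effective rat.
Proof.
apply: (@eq_semidec _ (fun n : nat => exists a d u v : nat, 0 < d /\
    ((u * d = v * a + 1 /\ n = pickle (([:: a], [::] : seq nat), ([:: d], [::] : seq nat))) \/
     (u * d = v * a.+1 + 1 /\ n = pickle ((([::] : seq nat), [:: a]), ([:: d], [::] : seq nat))))));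
  last by semidec_tac; apply: cfun_pickle; cfun_tac.
have bezoutP a d : 0 < d -> (exists u v, u * d = v * a + 1) <-> coprime a d.
  move=> d0; rewrite coprime_sym; split=> [[u [v uv]]|/(coprimeP _ d0)[[u v] /= uv]].
    by apply/coprimeP => //; exists (u, v); rewrite /= uv addKn.
  by exists u, v; lia.
have pickleE (a d : nat) (z : int) (zd : (0 < Posz d)%R && coprime `|z| d) s :
    int_parts z = s -> pickle (@Rat (z, Posz d) zd) = pickle (s, ([:: d], [::] : seq nat)).
  by move=> <-; rewrite -[LHS]/(pickle (z, Posz d)) !pickle_pair !pickle_int_parts.
move=> n; split.
  move=> [a [d [u [v [d0 [] [uv ->]]]]]].
    have cad : (0 < (d : int))%R && coprime `|(a : int)| d.
      by rewrite ltz_nat d0; apply/bezoutP => //; exists u, v.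
    by exists (@Rat (Posz a, Posz d) cad); exact: pickleE.
  have cad : (0 < (d : int))%R && coprime `|Negz a| d.
    by rewrite ltz_nat d0; apply/bezoutP => //; exists u, v.
  by exists (@Rat (Negz a, Posz d) cad); exact: pickleE.
move=> [[[z [d|d]] /= zd] <-] //; have /andP[] := zd; rewrite ltz_nat => d0 czd.
case: z zd czd => a zd czd; have /(bezoutP _ _ d0)[u [v uv]] := czd.
  by exists a, d, u, v; split=> //; left; split=> //; exact: (pickleE a).
by exists a, d, u, v; split=> //; right; split=> //; exact: (pickleE a).
Qed.

Definition mk_rat (s : seq nat) : rat :=
  (((nth 0 s 0)%:R - (nth 0 s 1)%:R) / (nth 0 s 2).+1%:R)%R.

(** Reduction to lowest terms is replaced by a search for the reduced fraction, since equality of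
    fractions is an equation between natural numbers. The denominator is stored minus one, so that
    every list denotes a fraction. *)
Lemma cfun_mk_rat (G : countType) (c : G -> seq nat) :
  cfun c -> cfun (fun g => mk_rat (c g)).
Proof.
apply: cfun_comp; apply: cfun_graph => [n|].
  by exists (CodeSeq.decode n); rewrite pickle_seqE map_id CodeSeq.decodeK.
apply: (@eq_semidec _ (fun z => num_pos z.1 * (nth 0 z.2 2).+1 + nth 0 z.2 1 * den z.1
    = nth 0 z.2 0 * den z.1 + num_neg z.1 * (nth 0 z.2 2).+1)).
  move=> [q s] /=; rewrite {5}(ratE q) /mk_rat.
  have d0 : ((den q)%:R != 0 :> rat)%R by rewrite pnatr_eq0 -lt0n den_gt0.
  have s0 : ((nth 0 s 2).+1%:R != 0 :> rat)%R by rewrite pnatr_eq0.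
  move: (num_pos q) (num_neg q) (den q) d0 => p m d d0.
  have crossP (p' m' d' a b e : rat) : (p' * e + b * d' = a * d' + m' * e)%R <->
      ((p' - m') * e = (a - b) * d')%R by split=> E; lra.
  split=> [/(congr1 (fun n => n%:R%R : rat))|/eqP].
    by rewrite !natrD !natrM => /crossP/eqP E; apply/eqP; rewrite eqr_div.
  rewrite eqr_div// => /eqP/crossP/eqP E.
  by apply/eqP; rewrite -(eqr_nat rat) !natrD !natrM.
by semidec_tac; do ?[apply: cfun_num_pos | apply: cfun_num_neg | apply: cfun_den]; cfun_tac.
Qed.

Section RatOps.
Context {G : countType}.
Implicit Types a b : G -> rat.

Lemma cfun_rat_add a b : cfun a -> cfun b -> cfun (fun g => (a g + b g)%R).
Proof.
move=> ca cb; apply: (@eq_cfun _ _ (fun g => mk_rat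
   [:: num_pos (a g) * den (b g) + num_pos (b g) * den (a g);
       num_neg (a g) * den (b g) + num_neg (b g) * den (a g);
       den (a g) * den (b g) - 1])).
  move=> g; rewrite /= [in RHS](ratE (a g)) [in RHS](ratE (b g)) /mk_rat /=.
  have := den_gt0 (a g); have := den_gt0 (b g).
  move: (num_pos _) (num_neg _) (den _) (num_pos _) (num_neg _) (den _) => p m d p' m' d' d0 d'0.
  rewrite -addn1 subnK ?muln_gt0 ?d0 ?d'0// !natrD !natrM; field.
  by rewrite !pnatr_eq0 -!lt0n d0 d'0.
have cap := cfun_num_pos ca; have can := cfun_num_neg ca; have cad := cfun_den ca.
have cbp := cfun_num_pos cb; have cbn := cfun_num_neg cb; have cbd := cfun_den cb.
by apply: cfun_mk_rat; cfun_tac.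
Qed.

Lemma cfun_rat_mul a b : cfun a -> cfun b -> cfun (fun g => (a g * b g)%R).
Proof.
move=> ca cb; apply: (@eq_cfun _ _ (fun g => mk_rat
   [:: num_pos (a g) * num_pos (b g) + num_neg (a g) * num_neg (b g);
       num_pos (a g) * num_neg (b g) + num_neg (a g) * num_pos (b g);
       den (a g) * den (b g) - 1])).
  move=> g; rewrite /= [in RHS](ratE (a g)) [in RHS](ratE (b g)) /mk_rat /=.
  have := den_gt0 (a g); have := den_gt0 (b g).
  move: (num_pos _) (num_neg _) (den _) (num_pos _) (num_neg _) (den _) => p m d p' m' d' d0 d'0.
  rewrite -addn1 subnK ?muln_gt0 ?d0 ?d'0// !natrD !natrM; field.
  by rewrite !pnatr_eq0 -!lt0n d0 d'0.
have cap := cfun_num_pos ca; have can := cfun_num_neg ca; have cad := cfun_den ca.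
have cbp := cfun_num_pos cb; have cbn := cfun_num_neg cb; have cbd := cfun_den cb.
by apply: cfun_mk_rat; cfun_tac.
Qed.

Lemma cfun_rat_le a b : cfun a -> cfun b -> cfun (fun g => (a g <= b g)%R).
Proof.
move=> ca cb; apply: (@eq_cfun _ _ (fun g =>
   num_pos (a g) * den (b g) + num_neg (b g) * den (a g) <=
   num_pos (b g) * den (a g) + num_neg (a g) * den (b g))).
  move=> g; rewrite /= [in RHS](ratE (a g)) [in RHS](ratE (b g)).
  have := den_gt0 (a g); have := den_gt0 (b g).
  move: (num_pos _) (num_neg _) (den _) (num_pos _) (num_neg _) (den _) => p m d p' m' d' d0 d'0.
  rewrite ler_pdivrMr ?ltr0n// mulrAC ler_pdivlMr ?ltr0n// -(ler_nat rat) !natrD !natrM.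
  by apply/idP/idP; lra.
have cap := cfun_num_pos ca; have can := cfun_num_neg ca; have cad := cfun_den ca.
have cbp := cfun_num_pos cb; have cbn := cfun_num_neg cb; have cbd := cfun_den cb.
by cfun_tac.
Qed.

Lemma cfun_rat_lt a b : cfun a -> cfun b -> cfun (fun g => (a g < b g)%R).
Proof.
move=> ca cb; apply: (@eq_cfun _ _ (fun g => ~~ (b g <= a g)%R)).
  by move=> g; rewrite ltNge.
exact/cfun_neg/cfun_rat_le.
Qed.

Lemma cfun_nat_rat (n : G -> nat) : cfun n -> cfun (fun g => (n g)%:R%R : rat).
Proof.
move=> cn; apply: (@eq_cfun _ _ (fun g => mk_rat [:: n g])).
  by move=> g; rewrite /mk_rat /= subr0 divr1.
by apply: cfun_mk_rat; cfun_tac.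
Qed.

End RatOps.

Local Open Scope classical_set_scope.
Local Open Scope ring_scope.

(** * Integrals of suprema of step functions *)

Lemma take_mkseq (T : Type) (f : nat -> T) k n :
  (k <= n)%N -> take k (mkseq f n) = mkseq f k.
Proof. by move=> kn; rewrite /mkseq -map_take take_iota (minn_idPl kn). Qed.

Lemma measurable_cylinder (x : word) : measurable (cylinder x : set Omega).
Proof. by apply: sub_sigma_algebra; exists x. Qed.

Section StepSup.
Context {R : realType}.
Local Open Scope ereal_scope.
Implicit Types (A : set (rat * word)) (w : Omega).

(** For finite [A] a step function, for infinite [A] a limit of such functions. The added 0 keeps
    the value nonnegative whatever rationals [A] contains. *)
Definition step_sup A w : \bar R :=
  ereal_sup (0 |` [set (ratr q.1)%:E | q in [set q | A q /\ cylinder q.2 w]]).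

Lemma step_sup_ge0 A w : 0 <= step_sup A w.
Proof. by apply: ereal_sup_ubound; left. Qed.

Lemma step_sup_ub A w q : A q -> cylinder q.2 w -> (ratr q.1)%:E <= step_sup A w.
Proof. by move=> Aq qw; apply: ereal_sup_ubound; right; exists q. Qed.

Lemma step_sup_le A w z : 0 <= z ->
  (forall q, A q -> cylinder q.2 w -> (ratr q.1)%:E <= z) -> step_sup A w <= z.
Proof.
by move=> z0 Az; apply: ge_ereal_sup => _ [->//|[q [Aq qw] <-]]; exact: Az.
Qed.

Lemma step_sup_sub A B w : A `<=` B -> step_sup A w <= step_sup B w.
Proof.
move=> AB; apply: step_sup_le => [|q Aq qw]; first exact: step_sup_ge0.
by apply: step_sup_ub => //; exact: AB.
Qed.

Lemma measurable_step_sup A : measurable_fun [set: Omega] (step_sup A).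
Proof.
apply: (measurability _ (ErealGenOInfty.measurableE R)) => _ [_ [r ->] <-].
rewrite setTI.
have -> : step_sup A @^-1` `]r%:E, +oo[ = (if (r < 0)%R then setT else set0)
    `|` \bigcup_(q in [set: rat * word])
          (if `[< A q /\ (r < ratr q.1)%R >] then cylinder q.2 else set0).
  apply/seteqP; split=> w /=.
    rewrite in_itv /= andbT => /ereal_sup_gt[_ [->|[q [Aq qw] <-]]].
      by rewrite lte_fin => ->; left.
    by rewrite lte_fin => rq; right; exists q => //; case: asboolP => // -[].
  rewrite in_itv /= andbT => -[|[q _]].
    by case: ifP => // r0 _; apply: lt_le_trans (step_sup_ge0 _ _); rewrite lte_fin.
  case: asboolP => // -[Aq rq] qw; apply: lt_le_trans (step_sup_ub Aq qw).
  by rewrite lte_fin.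
apply: measurableU; first by case: ifP.
apply: countable_bigcupT_measurable => // q.
by case: ifP => // _; exact: measurable_cylinder.
Qed.

Implicit Types P : measures R.

Lemma integral_step_sup_bigcup P (A : nat -> set (rat * word)) (c : \bar R) :
  (forall m n, (m <= n)%N -> A m `<=` A n) ->
  (forall n, \int[P]_w step_sup (A n) w <= c) ->
  \int[P]_w step_sup (\bigcup_n A n) w <= c.
Proof.
move=> ndA Ac.
have ndH w : {homo (fun n => step_sup (A n) w) : m n / (m <= n)%N >-> m <= n}.
  by move=> m n mn; apply: step_sup_sub; exact: ndA.
have -> : (fun w => step_sup (\bigcup_n A n) w) =
    (fun w => limn (fun n => step_sup (A n) w)).
  apply/funext => w; apply/esym/cvg_lim => //.
  suff -> : step_sup (\bigcup_n A n) w = ereal_sup (range (fun n => step_sup (A n) w)).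
    exact: ereal_nondecreasing_cvgn (ndH w).
  apply/eqP; rewrite eq_le; apply/andP; split.
    apply: step_sup_le => [|q [n _ Aq] qw].
      by apply: le_ereal_sup_tmp; exists (step_sup (A 0%N) w); [exists 0%N | exact: step_sup_ge0].
    apply: le_ereal_sup_tmp; exists (step_sup (A n) w); first by exists n.
    exact: step_sup_ub.
  by apply: ge_ereal_sup => _ [n _ <-]; apply: step_sup_sub => q Aq; exists n.
have cvgI := @cvg_monotone_convergence _ _ _ P setT measurableT
  (fun n w => step_sup (A n) w) (fun n => measurable_step_sup (A n))
  (fun n w _ => step_sup_ge0 (A n) w) (fun w _ => ndH w).
rewrite -(cvg_lim _ cvgI)//; apply: lime_le; first by apply/cvg_ex; eexists; exact: cvgI.
by apply: nearW => n; exact: Ac.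
Qed.

Lemma integral_step_sup0 P : \int[P]_w step_sup set0 w = 0.
Proof.
rewrite (eq_integral (fun=> 0)) ?integral0// => w _; apply/eqP.
by rewrite eq_le step_sup_ge0 andbT; apply: step_sup_le.
Qed.

(* The indices in N need not form an initial segment, but each partial union
   over N is still one of the sets [A n], or empty. *)
Lemma integral_step_sup_some P (A : nat -> set (rat * word)) (N : set nat) (c : \bar R) :
  (forall m n, (m <= n)%N -> A m `<=` A n) -> 0 <= c ->
  (forall n, N n -> \int[P]_w step_sup (A n) w <= c) ->
  \int[P]_w step_sup (\bigcup_(n in N) A n) w <= c.
Proof.
move=> ndA c0 Ac.
pose B m := \bigcup_(n in [set n | N n /\ (n < m)%N]) A n.
have -> : \bigcup_(n in N) A n = \bigcup_m B m.
  apply/seteqP; split=> q; last by move=> [m _ [n [Nn _] Aq]]; exists n.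
  by move=> [n Nn Aq]; exists n.+1 => //; exists n.
apply: integral_step_sup_bigcup => [m n mn q|m].
  by move=> [k [Nk km] Aq]; exists k => //; split=> //; exact: leq_trans mn.
have [->|[n Nn ->]] : B m = set0 \/ exists2 n, N n & B m = A n; last exact: Ac.
  elim: m => [|m IHm]; first by left; apply/seteqP; split=> q // [k []].
  have [Nm|Nm] := pselect (N m); last first.
    suff <- : B m = B m.+1 by [].
    apply/seteqP; split=> q [k [Nk km] Aq]; exists k => //; split=> //.
      exact: leq_trans km _.
    by move: km; rewrite ltnS leq_eqVlt => /orP[/eqP km|//]; rewrite km in Nk.
  right; exists m => //; apply/seteqP; split=> q; last by move=> Aq; exists m.
  by move=> [k [_ km] Aq]; apply: ndA Aq.
by rewrite integral_step_sup0.
Qed.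

Lemma cylinder_prefix (x y : word) w : cylinder y w -> prefix x y -> cylinder x w.
Proof.
rewrite /cylinder /= => yw; rewrite prefixE => /eqP xy.
have sxy : (size x <= size y)%N by rewrite -{1}xy size_take_min geq_minr.
by rewrite -(take_mkseq w sxy) yw.
Qed.

Lemma prefix_cylinder (x : word) w n :
  cylinder x w -> (size x <= n)%N -> prefix x (mkseq w n).
Proof. by move=> xw xn; rewrite prefixE take_mkseq//; exact/eqP. Qed.

Lemma cylinder_mkseq w n : cylinder (mkseq w n) w.
Proof. by rewrite /cylinder /= size_mkseq. Qed.

(** A triple (y, m, v) of [D] carries a bound m for the step function on the cylinder of y and a
    bound v for the probability of y; the sum of the m v then bounds the integral. P enters only
    through strict upper bounds on finitely many probabilities, which is an open condition. *)
Definition certified P (A : set (rat * word)) n (D : seq (word * rat * rat)) : Prop :=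
  [/\ forall y : word, size y = n -> exists2 d, d \in D & d.1.1 = y,
      forall q d, A q -> d \in D -> prefix q.2 d.1.1 -> (q.1 <= d.1.2)%R,
      forall d, d \in D -> (0 <= d.1.2)%R /\ P (cylinder d.1.1) < (ratr d.2)%:E &
      (\sum_(d <- D) d.1.2 * d.2 < 2)%R].

Lemma certified_integral P A n D :
  (forall q, A q -> (size q.2 <= n)%N) -> certified P A n D ->
  \int[P]_w step_sup A w <= 2%:E.
Proof.
move=> An [Dn AD DP D2].
(* The absolute value makes [f] nonnegative for all triples; on [D] it is the identity. *)
pose f (d : word * rat * rat) (w : Omega) : \bar R :=
  (ratr `|d.1.2|)%:E * (\1_(cylinder d.1.1) w)%:E.
have mf d : measurable_fun setT (f d).
  apply: measurable_funeM; apply/measurable_EFinP.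
  exact: measurable_indic (measurable_cylinder _).
have f0 d w : 0 <= f d w by rewrite /f -EFinM lee_fin mulr_ge0// ler0q.
apply: (@le_trans _ _ (\int[P]_w \sum_(d <- D) f d w)).
  apply: ge0_le_integral => //; try exact: measurable_step_sup.
  - by move=> w _; exact: step_sup_ge0.
  - exact: emeasurable_sum.
  move=> w _; apply: step_sup_le => [|q Aq qw]; first exact: sume_ge0.
  have [d dD dw] := Dn (mkseq w n) (size_mkseq _ _).
  rewrite (big_rem d)//=; apply: (@le_trans _ _ (f d w)); last first.
    by rewrite leeDl// sume_ge0.
  rewrite /f dw indicE mem_set ?mule1; last exact: cylinder_mkseq.
  rewrite lee_fin ler_rat (le_trans _ (ler_norm _))//; apply: AD dD _ => //.
  by rewrite dw; apply: prefix_cylinder (An _ Aq).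
rewrite ge0_integral_sum//.
apply: (@le_trans _ _ (\sum_(d <- D) (ratr (d.1.2 * d.2))%:E)).
  rewrite big_seq [leRHS]big_seq; apply: lee_sum => d dD.
  rewrite /f ge0_integralZl_EFin//; first last.
  - by rewrite ler0q.
  - by apply/measurable_EFinP; exact: measurable_indic (measurable_cylinder _).
  rewrite integral_indic ?setIT//; last exact: measurable_cylinder.
  have [d0 /ltW dP] := DP d dD.
  rewrite ger0_norm// rmorphM [leRHS]EFinM; apply: lee_wpmul2l => //.
  by rewrite lee_fin ler0q.
by rewrite sumEFin lee_fin -rmorph_sum -[leRHS](@ratr_nat R) ler_rat ltW.
Qed.

(** Each m is the value of the step function on its cylinder, and each v exceeds the probability by
    less than 1 / (M + 1), where M is the sum of the m. The sum of the products is then at most 1 +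
    M / (M + 1) < 2: here the gap between the bounds 1 and 2 is used. *)
Lemma exists_certified P A n (l : seq (rat * word)) :
  (forall q, A q -> q \in l) -> (forall q, A q -> (size q.2 <= n)%N) ->
  \int[P]_w step_sup A w <= 1 -> exists D, certified P A n D.
Proof.
move=> Al An A1.
pose lA (y : word) := [seq q.1 | q <- l & `[< A q >] && prefix q.2 y].
pose m (y : word) : rat := foldr Num.max 0%R (lA y).
have m_ub (s : seq rat) x : x \in s -> (x <= foldr Num.max 0 s)%R.
  elim: s => //= z s IHs; rewrite inE le_max => /orP[/eqP->|/IHs->]; last by rewrite orbT.
  by rewrite lexx.
have m_in (s : seq rat) : (foldr Num.max 0 s)%R \in 0%R :: s.
  elim: s => [|z s]; first by rewrite inE.
  rewrite !inE /= maxEle => IHs; case: ifP => _; last by rewrite eqxx orbT.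
  by case/orP: IHs => ->; rewrite ?orbT.
have m0 y : (0 <= m y)%R.
  by rewrite /m; elim: (lA y) => //= z s IHs; rewrite le_max IHs orbT.
have rm0 y : (0 <= ratr (m y) :> R)%R by rewrite ler0q.
pose W : finType := n.-tuple bool.
pose f (t : W) (w : Omega) : \bar R :=
  (ratr (m (val t)))%:E * (\1_(cylinder (val t)) w)%:E.
have mf t : measurable_fun setT (f t).
  apply: measurable_funeM; apply/measurable_EFinP.
  exact: measurable_indic (measurable_cylinder _).
have f0 t w : 0 <= f t w by rewrite /f -EFinM lee_fin mulr_ge0.
(* Only the term of the prefix of [w] of length n survives, and its coefficient is 0 or the rational
   of a pair of [A] whose cylinder contains [w]. *)
have fA w : \sum_(t : W) f t w <= step_sup A w.
  rewrite (bigD1 (Tuple (introT eqP (size_mkseq w n))))//= big1 ?adde0.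
    rewrite /f /= indicE mem_set ?mule1; last exact: cylinder_mkseq.
    have := m_in (lA (mkseq w n)); rewrite -/(m _) inE => /orP[/eqP->|].
      by rewrite rmorph0 step_sup_ge0.
    move=> /mapP[q]; rewrite mem_filter => /andP[/andP[/asboolP Aq qw] _] ->.
    by apply: step_sup_ub => //; exact: cylinder_prefix (cylinder_mkseq _ _) qw.
  move=> t tw; rewrite /f indicE memNset ?mule0// => /= tw'.
  case/eqP: tw; apply: val_inj => /=; rewrite -tw' /=.
  by rewrite size_tuple.
pose p (t : W) := fine (P (cylinder (val t))).
have pE t : P (cylinder (val t)) = (p t)%:E.
  by rewrite fineK// fin_num_measure//; exact: measurable_cylinder.
have mp : (\sum_(t : W) ratr (m (val t)) * p t <= 1)%R.
  rewrite -lee_fin -sumEFin; apply: le_trans A1.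
  apply: (@le_trans _ _ (\int[P]_w \sum_(t : W) f t w)); last first.
    apply: ge0_le_integral => //; try exact: measurable_step_sup.
    - by move=> w _; exact: sume_ge0.
    - exact: emeasurable_sum.
  rewrite ge0_integral_sum//; apply: lee_sum => t _.
  rewrite /f ge0_integralZl_EFin//; first last.
    by apply/measurable_EFinP; exact: measurable_indic (measurable_cylinder _).
  rewrite integral_indic ?setIT//; last exact: measurable_cylinder.
  by rewrite [leLHS]EFinM -pE.
pose M : R := (\sum_(t : W) ratr (m (val t)))%R.
have M0 : (0 <= M)%R by exact: sumr_ge0.
have /choice[v vP] (t : W) : exists q : rat, (p t < ratr q < p t + (M + 1)^-1)%R.
  have [|q] := @rat_in_itvoo R (p t) (p t + (M + 1)^-1)%R.
    by rewrite ltrDl invr_gt0 ltr_wpDl.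
  by rewrite in_itv /= => qP; exists q.
exists [seq (val t, m (val t), v t) | t <- enum W]; split.
- move=> y yn; have yn' : size y == n by apply/eqP.
  exists (y, m y, v (Tuple yn')) => //; apply/mapP; exists (Tuple yn') => //.
  exact: mem_enum.
- move=> q _ Aq /mapP[t _ ->] /= qt; apply: m_ub; apply/mapP; exists q => //.
  by rewrite mem_filter qt andbT Al// andbT; apply/asboolP.
- move=> _ /mapP[t _ ->] /=; split=> //.
  by rewrite pE lte_fin; have /andP[] := vP t.
rewrite big_map big_enum /= -(ltr_rat R) rmorph_sum /= ratr_nat.
apply: (@le_lt_trans _ _ (1 + M / (M + 1))%R); last first.
  have : (M / (M + 1) < 1)%R by rewrite ltr_pdivrMr ?mul1r ?ltrDl// ltr_wpDl.
  by lra.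
apply: (@le_trans _ _ (\sum_(t : W) (ratr (m (val t)) * p t + ratr (m (val t)) / (M + 1)))%R).
  apply: ler_sum => t _; rewrite rmorphM -mulrDr; apply: ler_wpM2l; first exact: rm0.
  by have /andP[_ /ltW] := vP t.
by rewrite big_split /= -mulr_suml lerD2r.
Qed.

End StepSup.

(** * Infima over effectively compact classes *)

#[global] Instance effective_word : effective word.
Proof. exact: effective_seq effective_bool. Qed.

#[global] Instance effective_basic : effective basic.
Proof.
exact: effective_seq (effective_pair (effective_pair effective_word effective_rat)
  effective_rat).
Qed.

Lemma cfun_prefix (G : countType) (x y : G -> word) :
  cfun x -> cfun y -> cfun (fun g => prefix (x g) (y g)).
Proof.
move=> cx cy; have {cx} cx : @cfun G (seq bool) x by [].
have {cy} cy : @cfun G (seq bool) y by [].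
apply: (@eq_cfun _ _ (fun g => (size (x g) <= size (y g))%N &&
   all (fun i => nth false (x g) i == nth false (y g) i) (iota 0 (size (x g))))).
  move=> g; rewrite prefixE; apply/idP/eqP => [/andP[xy /allP E]|E].
    apply: (@eq_from_nth _ false); first by rewrite size_takel.
    rewrite size_takel// => i ix; rewrite nth_take//; apply/esym/eqP/E.
    by rewrite mem_iota.
  apply/andP; split; first by rewrite -{1}E size_take_min geq_minr.
  by apply/allP => i; rewrite mem_iota /= add0n => ix; rewrite -{1}E nth_take.
apply: cfun_and; first exact: cfun_leq (cfun_size cx) (cfun_size cy).
apply: (cfun_ball (p := fun i g => nth false (x g) i == nth false (y g) i)).
  exact: cfun_size.
have c2 (h : G -> seq bool) : cfun h -> cfun (fun z : nat * G => nth false (h z.2) z.1).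
  move=> ch; apply: cfun_nth; last by cfun_tac.
  by apply: (cfun_comp ch); cfun_tac.
exact: cfun_eq (c2 _ cx) (c2 _ cy).
Qed.

Section EffectivelyCompact.
Context {R : realType}.
Local Open Scope ereal_scope.
Implicit Types (C : set (measures R)).

Lemma open_basic_set b : open (basic_set b : set (measures R)).
Proof.
exists [set basic_set b]; last by rewrite bigcup_set1.
by move=> _ ->; apply: (@finI_from1 _ _ _ id); exists b.
Qed.

Lemma compact_basic_cover C (D : set basic) : compact C ->
  C `<=` \bigcup_(b in D) basic_set b ->
  exists F : seq basic, {in F, forall b, D b} /\
    C `<=` \bigcup_(b in [set` F]) basic_set b.
Proof.
rewrite compact_cover => cC CD.
have [F FD CF] := cC _ _ _ (fun b _ => open_basic_set b) CD.
by exists (finmap.enum_fset F); split=> [b /FD /set_mem|].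
Qed.

Lemma lt_rat_between (r : R) (x : \bar R) :
  r%:E < x -> exists q : rat, r%:E < (ratr q)%:E < x.
Proof.
move=> rx; have [y ry yx] : exists2 y : R, (r < y)%R & y%:E <= x.
  case: x rx => [x rx||//]; first by exists x.
  by exists (r + 1)%R; rewrite ?ltrDl// leey.
have [q] := rat_in_itvoo ry; rewrite in_itv /= => /andP[rq qy].
by exists q; rewrite lte_fin rq (lt_le_trans _ yx)// lte_fin.
Qed.

Lemma measurable_fun_rat (f : Omega -> \bar R) :
  (forall r : rat, measurable [set w | (ratr r)%:E < f w]) ->
  measurable_fun setT f.
Proof.
move=> mf; apply: (measurability _ (ErealGenOInfty.measurableE R)) => _ [_ [r ->] <-].
rewrite setTI.
have -> : f @^-1` `]r%:E, +oo[ = \bigcup_(q : rat)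
    (if (r < ratr q)%R then [set w | (ratr q)%:E < f w] else set0).
  apply/seteqP; split=> w /=; rewrite in_itv /= andbT.
    by move=> /lt_rat_between[q /andP[rq qf]]; exists q => //; rewrite -lte_fin rq.
  by move=> [q _]; case: ifP => // rq; apply: lt_trans; rewrite lte_fin.
by apply: bigcupT_measurable_rat => q; case: ifP.
Qed.

Lemma lower_semicomputable_measurable (f : Omega -> \bar R) :
  lower_semicomputable cylinder f -> measurable_fun setT f.
Proof.
move=> [E _ fE]; apply: measurable_fun_rat => r; rewrite fE.
have -> : \bigcup_(x in [set x | E (r, x)]) cylinder x =
    \bigcup_(x : word) (if `[< E (r, x) >] then cylinder x else set0).
  apply/seteqP; split=> w [x]; first by move=> Ex xw; exists x => //; case: asboolP.
  by move=> _; case: asboolP => // Ex xw; exists x.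
apply: countable_bigcupT_measurable => // x.
by case: ifP => // _; exact: measurable_cylinder.
Qed.

Lemma lower_semicomputable_section (t : Omega * measures R -> \bar R) P :
  lower_semicomputable (@basic_prod R) t -> measurable_fun setT (fun w => t (w, P)).
Proof.
move=> [E _ tE]; apply: measurable_fun_rat => r.
have -> : [set w | (ratr r)%:E < t (w, P)] = \bigcup_(z : word * basic)
    (if `[< E (r, z) /\ basic_set z.2 P >] then cylinder z.1 else set0).
  have tE' w : (ratr r)%:E < t (w, P) <-> exists2 z, E (r, z) & basic_prod z (w, P).
    by have /seteqP[h1 h2] := tE r; split=> [/h1|/h2].
  apply/seteqP; split=> w /=.
    by move=> /tE'[z Ez [zw zP]]; exists z => //; case: asboolP => // -[].
  by move=> [z _]; case: asboolP => // -[Ez zP] zw; apply/tE'; exists z.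
apply: countable_bigcupT_measurable => // z.
by case: ifP => // _; exact: measurable_cylinder.
Qed.

(** Lets one interval around w serve all members of a finite cover at once: a prefix of w as long as
    the longest word of [l] extends them all. *)
Lemma cylinder_prefix_max (l : seq word) w :
  (forall x, x \in l -> cylinder x w) -> exists2 y, cylinder y w &
  forall x, x \in l -> prefix x y.
Proof.
move=> lw; exists (mkseq w (\max_(x <- l) size x)); first exact: cylinder_mkseq.
by move=> x xl; apply: prefix_cylinder (lw x xl) _; apply: leq_bigmax_seq.
Qed.

Lemma inf_test_lower_semicomputable C (t : Omega * measures R -> \bar R) :
  effectively_compact C -> lower_semicomputable (@basic_prod R) t ->
  lower_semicomputable cylinder (inf_test C t).
Proof.
move=> [cC /enumerable_semidec sC] [E /enumerable_semidec sE tE].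
have tE' r w P : (ratr r)%:E < t (w, P) <-> exists2 z, E (r, z) & basic_prod z (w, P).
  by have /seteqP[h1 h2] := tE r; split=> [/h1|/h2].
(* The intermediate [q] is essential: t > q at every P in C only gives an infimum at least q, and
   [z.1 < q] restores strictness. The word [z.2] extends a word x for every member of the cover, so
   its interval lies in all the corresponding cylinders. *)
pose E' (z : rat * word) := exists (q : rat) (F : seq basic),
  (z.1 < q)%R /\ (C `<=` \bigcup_(b in [set` F]) basic_set b /\
  forall b, b \in F -> exists x : word, prefix x z.2 /\ E (q, (x, b))).
exists E'.
  apply: semidec_enumerable; rewrite /E'.
  do 2!semidec_step; apply: semidec_and.
    by apply/semidec_bool/cfun_rat_lt; cfun_tac.
  apply: semidec_and; first by apply: (semidec_comp sC); cfun_tac.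
  apply: (semidec_all (P := fun b (z : rat * word * rat * seq basic) =>
    exists x : word, prefix x z.1.1.2 /\ E (z.1.2, (x, b)))); first by cfun_tac.
  semidec_step; apply: semidec_and.
    by apply/semidec_bool/cfun_prefix; cfun_tac.
  by apply: (semidec_comp sE); cfun_tac.
move=> r; apply/seteqP; split=> w /=.
  move=> /lt_rat_between[q /andP[]]; rewrite lte_fin ltr_rat => rq qt.
  pose D : set basic := [set b | exists2 x, E (q, (x, b)) & cylinder x w].
  have [|F [FD CF]] := @compact_basic_cover C D cC.
    move=> P CP; have /tE'[[x b] Exb [xw bP]] : (ratr q)%:E < t (w, P).
      by apply: lt_le_trans qt _; apply: ereal_inf_lbound; exists P.
    by exists b => //; exists x.
  have /choice[x xP] : forall b, exists x, b \in F -> E (q, (x, b)) /\ cylinder x w.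
    move=> b; have [/FD[x ? ?]|_] := boolP (b \in F); first by exists x.
    by exists [::].
  have [|y yw xy] := @cylinder_prefix_max [seq x b | b <- F] w.
    by move=> _ /mapP[b /xP[_ ?] ->].
  exists y => //; exists q, F; split=> //; split=> // b bF.
  by exists (x b); split; [apply: xy; exact: map_f | have [] := xP b bF].
move=> [y [q [F [/= rq [CF FE]]]] yw].
apply: (@lt_le_trans _ _ (ratr q)%:E); first by rewrite lte_fin ltr_rat.
apply: le_ereal_inf_tmp => _ [P CP <-]; apply/ltW/tE'.
have [b /FE[x [xy Exb]] bP] := CF P CP.
by exists (x, b) => //; split=> //=; exact: cylinder_prefix yw xy.
Qed.

Lemma inf_test_is_test C (t : Omega * measures R -> \bar R) :
  effectively_compact C -> is_uniform_test t -> is_test C (inf_test C t).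
Proof.
move=> eC [t0 lt t1]; have lC := inf_test_lower_semicomputable eC lt.
have inf0 w : 0 <= inf_test C t w by apply: le_ereal_inf_tmp => _ [P _ <-].
split=> // P CP; apply: le_trans (t1 P); apply: ge0_le_integral => //.
- exact: lower_semicomputable_measurable.
- exact: lower_semicomputable_section.
by move=> w _; apply: ereal_inf_lbound; exists P.
Qed.

End EffectivelyCompact.

(** * Trimming *)

Ltac semidec_all_step := lazymatch goal with
  | |- semidec (fun g => forall x, is_true (x \in @?s g) -> @?P x g) =>
      apply: (@semidec_all _ _ s P); cbv beta
  end.

Lemma cfun_sum (G T : countType) (x0 : T) (s : G -> seq T) (f : T -> rat) :
  cfun s -> cfun f -> cfun (fun g => \sum_(x <- s g) f x).
Proof.
move=> cs cf; apply: (@eq_cfun _ _ (fun g => nat_rect (fun=> rat) 0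
    (fun m r => r + f (nth x0 (s g) m)) (size (s g)))).
  move=> g; rewrite (big_nth x0); elim: (size (s g)) => [|n IHn] /=.
    by rewrite big_geq.
  by rewrite IHn big_nat_recr.
apply: (cfun_rec (h := fun m r g => r + f (nth x0 (s g) m)));
  [exact: cfun_size | exact: cfun_const |].
apply: cfun_rat_add; first by cfun_tac.
apply: (cfun_comp cf); apply: cfun_nth; last by cfun_tac.
by apply: (cfun_comp cs); cfun_tac.
Qed.

(** Turns the quantifier over words of length n in [certificate] into a bounded quantifier over
    numbers; the test is boolean because its negation has to be recognized too. *)
Definition binary_code (n c : nat) : bool :=
  let l := CodeSeq.decode c in
  (size l == n) && all (fun i => nth 0%N l i < 2)%N (iota 0 (size l)).

Lemma pickle_wordE (y : word) : pickle y = CodeSeq.code (map nat_of_bool y).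
Proof. by []. Qed.

Lemma binary_codeP n c :
  binary_code n c <-> exists2 y : word, size y = n & pickle y = c.
Proof.
rewrite /binary_code; split=> [/andP[/eqP ln /allP l2]|[y yn <-]].
  exists [seq b == 1%N | b <- CodeSeq.decode c]; first by rewrite size_map.
  rewrite pickle_wordE -map_comp -[RHS]CodeSeq.decodeK; congr CodeSeq.code.
  apply: (@eq_from_nth _ 0%N); first by rewrite size_map.
  move=> i; rewrite size_map => il; rewrite (nth_map 0%N)//=.
  by have := l2 i; rewrite mem_iota => /(_ il); case: (nth _ _ _) => [|[]].
rewrite pickle_wordE CodeSeq.codeK size_map yn eqxx /=.
apply/allP => i; rewrite mem_iota /= add0n -yn => iy.
by rewrite (nth_map false)//; case: nth.
Qed.

(** Prefixing a bit sends a code c to 2c + 1 or 4c + 2, and c < 4^n gives 4c + 2 < 4^(n+1). *)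
Lemma pickle_word_lt (y : word) : (pickle y < 4 ^ size y)%N.
Proof.
rewrite pickle_wordE; elim: y => //= b y IHy; rewrite expnS.
by case: b => /=; lia.
Qed.

Lemma size_lt_pickle (r : rat) (x : word) : (size x < pickle (r, x))%N.
Proof.
have xx : (size x <= pickle x)%N.
  rewrite pickle_wordE; elim: x => //= b y IHy.
  by case: b => /=; lia.
apply: (leq_ltn_trans xx); have /allP := CodeSeq.ltn_code [:: pickle r; pickle x].
by apply; rewrite !inE eqxx orbT.
Qed.

Lemma cfun_binary_code (G : countType) (n c : G -> nat) :
  cfun n -> cfun c -> cfun (fun g => binary_code (n g) (c g)).
Proof.
move=> cn cc; rewrite /binary_code; apply: cfun_and; first by cfun_tac.
apply: (cfun_ball (p := fun i g => (nth 0%N (CodeSeq.decode (c g)) i < 2)%N)).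
  by cfun_tac.
by cfun_tac; apply: (cfun_comp cc); cfun_tac.
Qed.

Section Trimming.
(* Stage k of an enumeration of the pairs (i, m) such that program i outputs m. *)
Context (p : nat * (nat * nat) -> bool) (cp : cfun p).
Context (pP : forall z, outputs z.1 z.2 <-> exists k, p (k, z)).

(** The bound on codes leaves finitely many pairs, with words of length at most n, so the step
    function is constant on cylinders of length n; the bound on k makes membership decidable. *)
Definition stage (i n : nat) : set (rat * word) :=
  [set q | (pickle q < n)%N /\ exists2 k, (k < n)%N & p (k, (i, pickle q))].

(* The form of [certified P (stage i n) n D] that does not mention P: the
   conditions on P are in the list b. *)
Definition certificate (i n : nat) (D : seq (word * rat * rat)) (b : basic) : Prop :=
  (forall c, (c < 4 ^ n)%N -> ~~ binary_code n c \/
    exists d, (d \in D) /\ pickle d.1.1 = c) /\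
  ((forall k, (k < n)%N -> forall m, (m < n)%N -> ~~ p (k, (i, m)) \/
    exists q : rat * word, pickle q = m /\
      forall d, d \in D -> ~~ prefix q.2 d.1.1 || (q.1 <= d.1.2)) /\
  ((forall d, d \in D -> 0 <= d.1.2 /\ (d.1.1, -1 : rat, d.2) \in b) /\
  \sum_(d <- D) d.1.2 * d.2 < 2)).

Lemma semidec_certificate : semidec (fun z : nat * nat * seq (word * rat * rat) * basic =>
  certificate z.1.1.1 z.1.1.2 z.1.2 z.2).
Proof.
rewrite /certificate; apply: semidec_and; [|apply: semidec_and; [|apply: semidec_and]].
- by semidec_tac; apply: cfun_binary_code; cfun_tac.
- semidec_step; first by cfun_tac.
  semidec_step; first by cfun_tac.
  apply: semidec_or.
    by apply/semidec_bool/cfun_neg/(cfun_comp cp); cfun_tac.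
  semidec_step; apply: semidec_and.
    by apply: semidec_eq; [apply: cfun_pickle|]; cfun_tac.
  semidec_all_step; first by cfun_tac.
  apply/semidec_bool/cfun_or; [apply/cfun_neg/cfun_prefix|apply: cfun_rat_le]; cfun_tac.
- semidec_all_step; first by cfun_tac.
  apply: semidec_and; first by apply/semidec_bool/cfun_rat_le; cfun_tac.
  by apply: semidec_mem; cfun_tac.
apply/semidec_bool/cfun_rat_lt; last by cfun_tac.
apply: (cfun_sum ([::], 0, 0) (f := fun d : word * rat * rat => d.1.2 * d.2)).
  by cfun_tac.
by apply: cfun_rat_mul; cfun_tac.
Qed.

Section Test.
Context {R : realType}.
Local Open Scope ereal_scope.
Implicit Types (P : measures R).

Lemma stage_size i n q : stage i n q -> (size q.2 <= n)%N.
Proof.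
case: q => r x [/= rxn _]; exact: ltnW (ltn_trans (size_lt_pickle r x) rxn).
Qed.

Lemma stage_nondecreasing i m n : (m <= n)%N -> stage i m `<=` stage i n.
Proof.
move=> mn q [qm [k km pk]]; split; first exact: leq_trans mn.
by exists k => //; exact: leq_trans mn.
Qed.

Lemma certificate_sound i n D b P :
  certificate i n D b -> basic_set b P -> certified P (stage i n) n D.
Proof.
move=> [Dn [stD [bD D2]]] bP; split=> //.
- move=> y yn; have yc : binary_code n (pickle y) by apply/binary_codeP; exists y.
  have [|/negP//|[d [dD /pickle_inj dy]]] := Dn (pickle y); last by exists d.
  by rewrite -yn pickle_word_lt.
- move=> q d [qn [k kn pk]] dD qd; have [/negP//|[q' [/pickle_inj -> /(_ d dD)]]] := stD k kn _ qn.
  by rewrite qd.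
- move=> d dD; have [d0 db] := bD d dD; split=> //.
  by have /andP[] := bP _ _ _ db.
Qed.

(** The condition on outputs holds for an index of a test. If program i outputs a number that is not
    the code of a pair, the second clause of [certificate] fails for all large n, and the trimmed
    function just stops growing. *)
Lemma certificate_complete i n D P :
  (forall m, outputs i m -> exists q : rat * word, pickle q = m) ->
  certified P (stage i n) n D ->
  exists2 b, basic_set b P & certificate i n D b.
Proof.
(* Basic conditions are two-sided; -1 is a lower bound that every probability exceeds. *)
move=> outi [Dn stD DP D2]; exists [seq (d.1.1, (-1)%R, d.2) | d <- D].
  move=> y u v /mapP[d dD [-> -> ->]]; apply/andP; split; last by have [] := DP d dD.
  apply: (@lt_le_trans _ _ 0); last exact: measure_ge0.
  by rewrite lte_fin ltrq0.
split.
  move=> c _; have [/binary_codeP[y yn <-]|_] := boolP (binary_code n c); last by left.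
  by right; have [d dD <-] := Dn y yn; exists d.
split; last first.
  split=> // d dD; split; first by have [] := DP d dD.
  by apply/mapP; exists d.
move=> k kn m mn; have [pk|_] := boolP (p (k, (i, m))); last by left.
right; have [|q qm] := outi m; first by apply/(pP (i, m)); exists k.
exists q; split=> // d dD; case: (boolP (prefix _ _)) => //= qd.
by apply: stD dD qd; rewrite /stage /= qm; split=> //; exists k.
Qed.

Definition certified_stages i P : set nat :=
  [set n | exists D b, certificate i n D b /\ basic_set b P].

Definition trimmed i P : set (rat * word) :=
  \bigcup_(n in certified_stages i P) stage i n.

Lemma integral_trimmed i P : \int[P]_w step_sup (trimmed i P) w <= 2%:E.
Proof.
apply: integral_step_sup_some => [m n|//|n [D [b [cert bP]]]].
  exact: stage_nondecreasing.
apply: certified_integral (certificate_sound cert bP).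
exact: stage_size.
Qed.

(** The clause for negative r, valid for every basic set, makes the supremum nonnegative. The other
    one puts r strictly below the weighted value 2^-(i+2) q of a pair in a certified stage of
    program i. *)
Definition trimmed_max_set : set (rat * (word * basic)) :=
  [set z | (z.1 < 0)%R \/ exists (i n k : nat) (q : rat) (D : seq (word * rat * rat)),
    (k < n)%N /\ ((pickle (q, z.2.1) < n)%N /\ (p (k, (i, pickle (q, z.2.1))) /\
    ((z.1 * (2 ^ i.+2)%:R < q)%R /\ certificate i n D z.2.2)))].

Lemma enumerable_trimmed_max_set : enumerable trimmed_max_set.
Proof.
apply: semidec_enumerable; rewrite /trimmed_max_set; apply: semidec_or.
  by apply/semidec_bool/cfun_rat_lt; cfun_tac.
do 5!semidec_step; apply: semidec_and; first by semidec_tac.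
apply: semidec_and; first by semidec_tac.
apply: semidec_and; first by apply/semidec_bool/(cfun_comp cp); cfun_tac.
apply: semidec_and.
  apply/semidec_bool/cfun_rat_lt; last by cfun_tac.
  by apply: cfun_rat_mul; [|apply: cfun_nat_rat]; cfun_tac.
apply: (semidec_comp (a := fun z => (_, _, _, _)) semidec_certificate).
by cfun_tac.
Qed.

Definition trimmed_max (z : Omega * measures R) : \bar R :=
  ereal_sup [set (ratr r)%:E | r in
    [set r | exists2 b, trimmed_max_set (r, b) & basic_prod b z]].

(** The conditions on r in [trimmed_max_set] are strict, hence leave room to increase r: to [r / 2]
    if r is negative, otherwise to the midpoint of r and the weighted value. So the supremum
    strictly exceeds every r listed at z. *)
Lemma trimmed_max_gtP r z :
  (ratr r)%:E < trimmed_max z <-> exists2 b, trimmed_max_set (r, b) & basic_prod b z.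
Proof.
split=> [/ereal_sup_gt[_ [q [b qb bz] <-]]|[b rb bz]].
  rewrite lte_fin ltr_rat => rq; exists b => //.
  case: qb => [/= q0|[i [n [k [x [D [kn [xn [pk [/= qx cert]]]]]]]]]].
    by left; exact: lt_trans q0.
  right; exists i, n, k, x, D; do 3!split=> //; split=> //=.
  by apply: le_lt_trans qx; rewrite ler_pM2r ?ltr0n ?expn_gt0// ltW.
suff [q rq qb] : exists2 q, (r < q)%R & trimmed_max_set (q, b).
  apply: (@lt_le_trans _ _ (ratr q)%:E); first by rewrite lte_fin ltr_rat.
  by apply: ereal_sup_ubound; exists q => //; exists b.
case: rb => [/= r0|[i [n [k [x [D [kn [xn [pk [/= rx cert]]]]]]]]]].
  by exists (r / 2)%R; [lra | left => /=; lra].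
have c0 : (0 < (2 ^ i.+2)%:R :> rat)%R by rewrite ltr0n expn_gt0.
have rx' : (r < x / (2 ^ i.+2)%:R)%R by rewrite ltr_pdivlMr.
exists ((r + x / (2 ^ i.+2)%:R) / 2)%R; first by lra.
right; exists i, n, k, x, D; do 3!split=> //; split=> //=.
rewrite -ltr_pdivlMr//; lra.
Qed.

Lemma trimmed_max_ge0 z : 0 <= trimmed_max z.
Proof.
rewrite leNgt; apply/negP; rewrite -oppe_gt0 => /lt_rat_between[q /andP[]].
rewrite lte_fin ltr0q lteNr -EFinN -rmorphN => q0; apply/negP; rewrite -leNgt.
apply/ltW/trimmed_max_gtP; exists ([::], [::]); last by split.
by left; rewrite /= oppr_lt0.
Qed.

Lemma trimmed_max_lsc : lower_semicomputable (@basic_prod R) trimmed_max.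
Proof.
exists trimmed_max_set; first exact: enumerable_trimmed_max_set.
move=> r; apply/seteqP; split=> z /=; first by move/trimmed_max_gtP.
by move=> rz; exact/trimmed_max_gtP.
Qed.

Let c (i : nat) : R := ((2 ^ i.+2)%:R)^-1%R.

(** The supremum is easy to enumerate; the sum, which is larger because its terms are nonnegative,
    can be integrated term by term. *)
Lemma trimmed_max_le w P :
  trimmed_max (w, P) <= \sum_(0 <= i <oo) (c i)%:E * step_sup (trimmed i P) w.
Proof.
have c0 i : (0 <= c i)%R by rewrite invr_ge0.
have t0 i : 0 <= (c i)%:E * step_sup (trimmed i P) w.
  by rewrite mule_ge0 ?lee_fin// step_sup_ge0.
apply: ge_ereal_sup => _ [r [[x b] rb [/= xw bP]] <-].
case: rb => [/= r0|[i [n [k [q [D [kn [xn [pk [/= rq cert]]]]]]]]]].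
  apply: le_trans (nneseries_ge0 _); last by [].
  by rewrite lee_fin lerq0 ltW.
apply: (@le_trans _ _ ((c i)%:E * step_sup (trimmed i P) w)).
  apply: (@le_trans _ _ ((c i)%:E * (ratr q)%:E)).
    rewrite -EFinM lee_fin /c mulrC ler_pdivlMr ?ltr0n ?expn_gt0//.
    by rewrite -[X in (_ * X)%R](@ratr_nat R) -rmorphM ler_rat ltW.
  apply: lee_wpmul2l; first by rewrite lee_fin.
  apply: (@step_sup_ub _ _ _ (q, x)) => //; exists n; first by exists D, b.
  by split=> //; exists k.
by rewrite (@nneseriesD1 _ _ i)// leeDl// nneseries_ge0.
Qed.

Lemma trimmed_max_uniform_test : is_uniform_test trimmed_max.
Proof.
split; [exact: trimmed_max_ge0 | exact: trimmed_max_lsc |] => P.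
have c0 i : (0 <= c i)%R by rewrite invr_ge0.
have t0 i w : 0 <= (c i)%:E * step_sup (trimmed i P) w.
  by rewrite mule_ge0 ?lee_fin// step_sup_ge0.
have mt i : measurable_fun setT (fun w => (c i)%:E * step_sup (trimmed i P) w).
  by apply: measurable_funeM; exact: measurable_step_sup.
apply: (@le_trans _ _ (\int[P]_w \sum_(0 <= i <oo) (c i)%:E * step_sup (trimmed i P) w)).
  apply: ge0_le_integral => //.
  - by move=> w _; exact: trimmed_max_ge0.
  - exact: lower_semicomputable_section trimmed_max_lsc.
  - by apply: ge0_emeasurable_sum => // i w _ _; exact: t0.
  by move=> w _; exact: trimmed_max_le.
rewrite integral_nneseries//.
(* The weight 2^-(i+2) times the bound 2 is 2^-(i+1); the summand 0 gives the series the shape of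
   [epsilon_trick], which bounds it by 1. *)
apply: (@le_trans _ _ (\sum_(0 <= i <oo) (0 + (1 / (2 ^ i.+1)%:R)%:E))).
  apply: lee_nneseries => i _; first by rewrite integral_ge0.
  rewrite add0e ge0_integralZl_EFin//; last exact: measurable_step_sup.
    apply: le_trans (lee_wpmul2l _ (integral_trimmed i P)) _; first by rewrite lee_fin.
    rewrite -EFinM lee_fin /c expnS natrM invfM mulrAC mulVf// mul1r//.
  by move=> w _; exact: step_sup_ge0.
apply: le_trans (epsilon_trick _ _ _) _ => //.
by rewrite eseries0// add0e.
Qed.

(** Trimming removes nothing from a test at P in C: all stages of its index e lie below s, so they
    have integral at most 1 and own a certificate satisfied by P. Only the weight 2^-(e+2) is lost,
    and its inverse is the constant. *)
Lemma trimmed_max_dominates (C : set (measures R)) s : is_test C s ->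
  exists2 a : R, (0 < a)%R & forall w P, C P -> s w <= a%:E * trimmed_max (w, P).
Proof.
move=> [s0 ls s1]; have ms := lower_semicomputable_measurable ls.
have [E /enumerable_outputs[e eE] sE] := ls.
have sE' r w : (ratr r)%:E < s w <-> exists2 x, E (r, x) & cylinder x w.
  by have /seteqP[h1 h2] := sE r; split=> [/h1|/h2].
have stE n : stage e n `<=` E.
  move=> q [_ [k _ pk]]; have /eE[q' Eq' /pickle_inj <-//] : outputs e (pickle q).
  by apply/(pP (e, _)); exists k.
have a0 : (0 < (2 ^ e.+2)%:R :> R)%R by rewrite ltr0n expn_gt0.
have a0' : (0 < (2 ^ e.+2)%:R :> rat)%R by rewrite ltr0n expn_gt0.
exists (2 ^ e.+2)%:R%R => // w P CP.
have cert n : exists D b, certificate e n D b /\ basic_set b P.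
  have [|||D certD] := @exists_certified R P (stage e n) n (pmap unpickle (iota 0 n)).
  - move=> q [qn _]; rewrite mem_pmap; apply/mapP; exists (pickle q).
      by rewrite mem_iota.
    by rewrite pickleK.
  - exact: stage_size.
  - apply: le_trans (s1 P CP); apply: ge0_le_integral => //; try exact: measurable_step_sup.
      by move=> w' _; exact: step_sup_ge0.
    move=> w' _; apply: step_sup_le => // -[r x] /stE Erx xw.
    by apply/ltW/sE'; exists x.
  have [|b bP certb] := certificate_complete _ certD; last by exists D, b.
  by move=> m /eE[q _ qm]; exists q.
set u := trimmed_max (w, P); rewrite leNgt; apply/negP => us.
have u0 : 0 <= u by exact: trimmed_max_ge0.
have [v uv] : exists v, u = v%:E.
  case: u u0 us => [v||//] _; first by exists v.
  by rewrite gt0_muley ?lte_fin// ltNge leey.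
rewrite uv -EFinM in us; have [q /andP[vq /sE'[x Eqx xw]]] := lt_rat_between us.
have : (v < ratr q / (2 ^ e.+2)%:R)%R by rewrite ltr_pdivlMr// mulrC -lte_fin.
move=> /rat_in_itvoo[r]; rewrite in_itv /= => /andP[vr rq].
suff : (ratr r)%:E < u by rewrite uv lte_fin ltNge ltW.
have [k pk] : exists k, p (k, (e, pickle (q, x))) by apply/(pP (e, _))/eE; exists (q, x).
(* Large enough for stage n to contain (q, x): both the accepting stage k and the code lie below
   it. *)
pose n := (maxn k (pickle (q, x))).+1.
have [D [b [certb bP]]] := cert n.
apply/trimmed_max_gtP; exists (x, b) => //; right; exists e, n, k, q, D.
split; first by rewrite ltnS leq_maxl.
split; first by rewrite /= ltnS leq_maxr.
split=> //; split=> //=; rewrite -ltr_pdivlMr// -(ltr_rat R) fmorph_div /= ratr_nat; exact: rq.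
Qed.

End Test.
End Trimming.

(** * Universality of the infimum *)

Lemma exists_dominating_uniform_test (R : realType) :
  exists2 u : Omega * measures R -> \bar R, is_uniform_test u &
  forall (C : set (measures R)) s, is_test C s ->
    exists2 a : R, (0 < a)%R & forall w P, C P -> (s w <= a%:E * u (w, P))%E.
Proof.
have [p cp pP] := semidec_stages semidec_outputs.
exists (trimmed_max p); first exact: trimmed_max_uniform_test.
exact: trimmed_max_dominates.
Qed.

(** The constant belonging to s does not depend on P, so the domination passes to the infimum over
    C. *)
Lemma inf_test_universal (R : realType) (C : set (measures R)) u :
  effectively_compact C -> is_uniform_test u ->
  (forall s, is_test C s ->
    exists2 a : R, (0 < a)%R & forall w P, C P -> (s w <= a%:E * u (w, P))%E) ->
  universal_test C (inf_test C u).
Proof.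
move=> eC ut domu; split=> [|s /domu[a a0 sa]]; first exact: inf_test_is_test.
exists a => // w; rewrite -lee_pdivrMl//; apply: le_ereal_inf_tmp => _ [P CP <-].
by rewrite lee_pdivrMl//; exact: sa.
Qed.

Theorem theorem15 (R : realType) (C : set (measures R)) :
  effectively_compact C ->
  (exists tC : Omega -> \bar R, universal_test C tC) /\
  (forall t : Omega * measures R -> \bar R, universal_uniform_test t ->
     (forall tC : Omega -> \bar R, universal_test C tC ->
        eq_up_to_factor tC (inf_test C t)) /\
     universal_test C (inf_test C t)).
Proof.
move=> eC; have [u ut domu] := exists_dominating_uniform_test R.
split; first by exists (inf_test C u); apply: inf_test_universal => //; exact: domu.
move=> t [tt /(_ u ut)[a a0 ua]].
have univ : universal_test C (inf_test C t).
  (* Maximality of [t] transfers the domination property from [u] to [t], with the product of the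
     two constants. *)
  apply: inf_test_universal => // s /domu[c c0 sc]; exists (c * a); first exact: mulr_gt0.
  move=> w P CP; apply: le_trans (sc w P CP) _.
  by rewrite EFinM -muleA; apply: lee_wpmul2l; [rewrite lee_fin ltW | exact: ua].
split=> // tC [tCt tCu]; have [inft infu] := univ.
by split; [exact: infu | exact: tCu].
Qed.
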